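(* Let $L_1,L_2,L_3>0$, $k_{ap}>0$, $k_{ad}>0$ be given, let $f\in\mathcal F$ (the class with constants $L_1,L_2,L_3$), let $(x_1(0),x_2(0))\in\mathbb R^2$ be any initial value and $y^{**}\in\mathbb R$ any setpoint (the limit of the reference signal $y^*$). Consider the plant $$\dot x_1=x_2,\qquad \dot x_2=f(x_1,x_2,t)+u(t)$$ under the PID controller $$u=-k_p(x_1-r)-k_d(x_2-\dot r)-k_i\int_0^t(x_1(\tau)-r(\tau))\,d\tau+\ddot r$$ with parameters $$k_p=k_{ap}+\omega_ok_{ad},\qquad k_d=k_{ad}+\omega_o,\qquad k_i=\omega_ok_{ap}.$$ Let $e(t)=r(t)-x_1(t)$, and let $\omega_o^*=\omega_o^*(L_1,L_2,k_{ap},k_{ad})$ be the explicit constant defined in the context. Then there exist positive constants $\eta_1,\eta_2$, which depend on $(e_f(0),k_{ap},k_{ad},L_1,L_2,L_3,\dot r,\ddot r)$ and which are also constants for which the ADRC closed loop described in the context satisfies $|\ddot e(t)+k_{ad}\dot e(t)+k_{ap}e(t)|=|e_f(t)|\le\eta_1e^{-\omega_ot}+\eta_2/\omega_o$ for all $t\ge0$ and all $\omega_o>\omega_o^*$, such that whenever $\omega_o>\omega_o^*$ the PID closed-loop system has the following properties: (1) $\lim_{t\to\infty}x_1(t)=y^{**}$ and $\lim_{t\to\infty}x_2(t)=0$. (2) $|\ddot e(t)+k_{ad}\dot e(t)+k_{ap}e(t)|\le\eta_1e^{-\omega_ot}+\dfrac{\eta_2}{\omega_o}$ for all $t\ge 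0$.
   Context: Reference signal: $y^*(t)$ is a given bounded, twice differentiable real signal on $[0,\infty)$ with $\lim_{t\to\infty}y^*(t)=y^{**}$ (a constant), $\lim_{t\to\infty}\dot y^*(t)=0$, $\lim_{t\to\infty}\ddot y^*(t)=0$. Desired transient process: $r$ is the solution of the stable linear filter $\ddot r=-2c_r\dot r-c_r^2(r-y^*(t))$, $r(0)=x_1(0)$, $\dot r(0)=x_2(0)$, with a parameter $c_r>0$. ADRC closed loop: the same plant, with observer $\dot\xi=-\omega_o\xi-\omega_o^2x_2-\omega_ou$, $\xi(0)=-\omega_ox_2(0)$, $\hat f=\xi+\omega_ox_2$, and control law $u=-k_{ap}(x_1-r)-k_{ad}(x_2-\dot r)-\hat f+\ddot r$, started from the same initial value and with the same $r$; here $e=r-x_1$ and $e_f=\hat f-f(x_1,x_2,t)$, so that $e_f(0)=-f(x_1(0),x_2(0),0)$. Function class: for positive constants $L_1,L_2,L_3$, $$\mathcal F=\Big\{f\in C^1(\mathbb R^2\times\mathbb R^+)\ \Big|\ f(x_1,x_2,t)=h(x_1,x_2)+w(t),\ \Big|\tfrac{\partial h}{\partial x_1}\Big|\le L_1,\ \Big|\tfrac{\partial h}{\partial x_2}\Big|\le L_2,\ |w(t)|\le L_3,\ |\dot w(t)|\le L_3,\ \lim_{t\to\infty}w(t)\text{ exists},\ \forall x_1,x_2\in\mathbb R,\ \forall t\in\mathbb R^+\Big\},$$ where $C^1(\mathbb R^2\times\mathbb R^+)$ denotes the functions $\mathbb R^2\times\mathbb R^+\to\mathbb R$ that are continuous in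 $(x_1,x_2)$ and $t$, with continuous partial derivatives with respect to $(x_1,x_2)$. The constant $\omega_o^*$: let $$\Omega=\{\omega\in\mathbb R \mid n_0\omega^4+n_1\omega^3+n_2\omega^2+n_3\omega+n_4=0\},$$ with $n_0=k_{ad}^2$, $n_1=2k_{ad}[k_{ad}(k_{ad}-L_2)-L_1]$, $n_2=2k_{ad}(k_{ap}-L_1)(k_{ad}-L_2)+[k_{ad}(k_{ad}-L_2)-L_1]^2-L_2^2k_{ap}$, $n_3=2[k_{ad}(k_{ad}-L_2)-L_1](k_{ap}-L_1)(k_{ad}-L_2)-L_2^2k_{ap}(k_{ad}-L_2)$, $n_4=(k_{ap}-L_1)^2(k_{ad}-L_2)^2$. Put $\bar\omega_o=0$ if $\Omega=\varnothing$ or $\max\Omega\le 0$, and $\bar\omega_o=\max\Omega$ if $\max\Omega>0$. Then $$\omega_o^*=\max\Big\{0,\ \frac{L_1-k_{ap}}{k_{ad}},\ L_2-k_{ad},\ \bar\omega_o\Big\}.$$ *)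

(* Defs.v *)
From Stdlib Require Import Reals Lra.
From Coquelicot Require Import Coquelicot.

Open Scope R_scope.

(* Signals live on [0, +oo) but are represented by total functions on R, whose
   values at negative times are irrelevant.  [D_in] is the derivative relative
   to a set, so it is one-sided at t = 0 and two-sided at every t > 0. *)
Definition deriv_nonneg (g dg : R -> R) : Prop :=
  forall t, 0 <= t -> D_in g dg (fun s => 0 <= s) t.

(* A point of R^2 x R^+ is a triple ((x1, x2), t) with 0 <= t. *)
Definition continuous_R2Rplus (g : R -> R -> R -> R) : Prop :=
  continuous_on (fun p : R * R * R => 0 <= snd p)
    (fun p : R * R * R => g (fst (fst p)) (snd (fst p)) (snd p)).

Definition class_C1 (f : R -> R -> R -> R) : Prop :=
  continuous_R2Rplus f /\
  exists f1 f2 : R -> R -> R -> R,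
    (forall x1 x2 t, 0 <= t ->
       is_derive (fun x => f x x2 t) x1 (f1 x1 x2 t) /\
       is_derive (fun x => f x1 x t) x2 (f2 x1 x2 t)) /\
    continuous_R2Rplus f1 /\
    continuous_R2Rplus f2.

Definition class_F (L1 L2 L3 : R) (f : R -> R -> R -> R) : Prop :=
  class_C1 f /\
  exists (h h1 h2 : R -> R -> R) (w dw : R -> R),
    (forall x1 x2 t, 0 <= t -> f x1 x2 t = h x1 x2 + w t) /\
    (forall x1 x2,
       is_derive (fun x => h x x2) x1 (h1 x1 x2) /\
       is_derive (fun x => h x1 x) x2 (h2 x1 x2) /\
       Rabs (h1 x1 x2) <= L1 /\
       Rabs (h2 x1 x2) <= L2) /\
    deriv_nonneg w dw /\
    (forall t, 0 <= t -> Rabs (w t) <= L3 /\ Rabs (dw t) <= L3) /\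
    ex_finite_lim w p_infty.

Definition reference_signal (ystar : R -> R) (yss : R) : Prop :=
  exists dy ddy : R -> R,
    (exists M, forall t, 0 <= t -> Rabs (ystar t) <= M) /\
    deriv_nonneg ystar dy /\
    deriv_nonneg dy ddy /\
    is_lim ystar p_infty yss /\
    is_lim dy p_infty 0 /\
    is_lim ddy p_infty 0.

Definition transient_process (cr : R) (ystar : R -> R) (x10 x20 : R)
    (r dr ddr : R -> R) : Prop :=
  deriv_nonneg r dr /\
  deriv_nonneg dr ddr /\
  (forall t, 0 <= t ->
     ddr t = - 2 * cr * dr t - cr ^ 2 * (r t - ystar t)) /\
  r 0 = x10 /\
  dr 0 = x20.

Definition plant (f : R -> R -> R -> R) (x10 x20 : R) (u x1 x2 : R -> R)
    : Prop :=
  deriv_nonneg x1 x2 /\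
  deriv_nonneg x2 (fun t => f (x1 t) (x2 t) t + u t) /\
  x1 0 = x10 /\
  x2 0 = x20.

Definition ADRC_closed_loop (f : R -> R -> R -> R) (kap kad omega_o : R)
    (x10 x20 : R) (r dr ddr : R -> R) (x1 x2 xi fhat u : R -> R) : Prop :=
  plant f x10 x20 u x1 x2 /\
  deriv_nonneg xi
    (fun t => - omega_o * xi t - omega_o ^ 2 * x2 t - omega_o * u t) /\
  xi 0 = - omega_o * x2 0 /\
  (forall t, 0 <= t -> fhat t = xi t + omega_o * x2 t) /\
  (forall t, 0 <= t ->
     u t = - kap * (x1 t - r t) - kad * (x2 t - dr t) - fhat t + ddr t).

Definition PID_closed_loop (f : R -> R -> R -> R) (kp kd ki : R)
    (x10 x20 : R) (r dr ddr : R -> R) (x1 x2 u : R -> R) : Prop :=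
  plant f x10 x20 u x1 x2 /\
  (forall t, 0 <= t ->
     u t = - kp * (x1 t - r t) - kd * (x2 t - dr t)
           - ki * RInt (fun tau => x1 tau - r tau) 0 t + ddr t).

Definition Omega (L1 L2 kap kad : R) (w : R) : Prop :=
  let n0 := kad ^ 2 in
  let n1 := 2 * kad * (kad * (kad - L2) - L1) in
  let n2 := 2 * kad * (kap - L1) * (kad - L2)
            + (kad * (kad - L2) - L1) ^ 2 - L2 ^ 2 * kap in
  let n3 := 2 * (kad * (kad - L2) - L1) * (kap - L1) * (kad - L2)
            - L2 ^ 2 * kap * (kad - L2) in
  let n4 := (kap - L1) ^ 2 * (kad - L2) ^ 2 in
  n0 * w ^ 4 + n1 * w ^ 3 + n2 * w ^ 2 + n3 * w + n4 = 0.

Definition is_max (A : R -> Prop) (m : R) : Prop :=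
  A m /\ forall w, A w -> w <= m.

(* For kad > 0 the polynomial is not zero, so [Omega] is finite and, when it is
   nonempty, its least upper bound is its maximum.  When it is empty, the bound
   is -oo and [real m_infty = 0].  See [omega_bar_max] and [omega_bar_empty]. *)
Definition omega_bar (L1 L2 kap kad : R) : R :=
  let m := real (Lub_Rbar (Omega L1 L2 kap kad)) in
  if Rlt_dec 0 m then m else 0.

Lemma omega_bar_max (L1 L2 kap kad m : R) :
  is_max (Omega L1 L2 kap kad) m ->
  omega_bar L1 L2 kap kad = if Rlt_dec 0 m then m else 0.
Proof.
intros [Hm Hub]; unfold omega_bar.
rewrite (is_lub_Rbar_unique _ (Finite m)); [reflexivity|].
split.
- intros x Hx; exact (Hub x Hx).
- intros b Hb; exact (Hb m Hm).
Qed.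

Lemma omega_bar_empty (L1 L2 kap kad : R) :
  (forall w, ~ Omega L1 L2 kap kad w) -> omega_bar L1 L2 kap kad = 0.
Proof.
intros H; unfold omega_bar.
rewrite (is_lub_Rbar_unique _ m_infty).
- simpl; destruct (Rlt_dec 0 0); reflexivity.
- split.
  + intros x Hx; destruct (H x Hx).
  + intros b _; destruct b; exact I.
Qed.

Definition omega_star (L1 L2 kap kad : R) : R :=
  Rmax 0 (Rmax ((L1 - kap) / kad)
            (Rmax (L2 - kad) (omega_bar L1 L2 kap kad))).

(* Main.v *)
Require Import Defs.
From Stdlib Require Import Reals Lra Psatz Classical.
From Coquelicot Require Import Coquelicot.

Open Scope R_scope.

(** Both controllers close the same loop.  The observer satisfies
    [fhat' = - om (fhat - f)], and [fhat - f = e'' + kad e' + kap e], so that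
    [Y = - fhat - om (kad e + e')] is the integral term [om kap ∫e] of the PID
    law ([ADRC_integral_loop], [PID_integral_loop]).  It remains to study one
    loop with states [x1, x2, Y], where [estimation_error] stands for
    [fhat - f].

    Let [A = om + kad - L2], [B = kap - L1 + om kad] and [C = om kap].  Above
    [omega_star] these are positive, [A B > C], and
    [L2 ^ 2 A C < (A B - C) ^ 2] ([stability_above_threshold]).  In the
    coordinates [p = yss - x1], [q = p'] and a shift [y] of [Y], the loop is
    the forced system
    [p' = q], [q' = - y - phi p - (A + theta) q + g], [y' = C (p + rho)], where
    [phi] has slopes at least [B] and [theta] ranges over [0, 2 L2].  The
    dependence of [f] on position enters the Lyapunov function through a
    primitive of [phi], hence without loss; the dependence on velocity is a
    time-varying damping, and the quadratic inequality is what it costs.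
    The forcing [g, rho] is bounded, and vanishes at infinity, so the state is
    bounded ([lure_bounded]) and tends to the setpoint ([lure_converges]).

    The difficulty is that [eta1] and [eta2] must serve all [om] above the
    threshold.
    - When the threshold is positive, the symmetric choice of the quadratic part
      of the Lyapunov function would lose strictness at [om = omega_star].
      Moving the centre of the damping range off the middle keeps a margin
      there ([dissipative_uniform]); and no coefficient except [C] can vanish
      at the threshold ([threshold_nondegenerate]).
    - If the threshold is [0], the state is bounded by a multiple of
      [1 / sqrt om] as [om] tends to [0] ([estimation_error_bounded_bandwidth]).
    - For large [om], the variables [e], [e'] and [s = fhat - f] form a cascade
      whose Lyapunov function does not involve [om]; along it the derivative of
      [f] is bounded by some [eta], and [s' = - om s - f'] gives
      [|s| <= |s(0)| exp(- om t) + eta / om]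
      ([estimation_error_large_bandwidth]).

    The constants see the reference only through bounds on [r - yss], [r'] and
    [r'']; the first is determined by [r'] ([deviation_determined_by_velocity]),
    so that such bounds can be chosen from [r'] and [r''] alone. *)

(** * Signals on the half-line *)

Definition smooth (g dg : R -> R) : Prop :=
  forall t, 0 <= t -> is_derive g t (dg t).

(** Continuing a signal to negative times along its tangent at [0] makes the
    one-sided derivative at [0] two-sided, so that the usual calculus of
    derivatives applies on the whole closed half-line. *)
Lemma smooth_extension (g dg : R -> R) :
  deriv_nonneg g dg ->
  exists G : R -> R, (forall t, 0 <= t -> G t = g t) /\ smooth G dg.
Proof.
intros H.
set (G := fun t => if Rle_dec 0 t then g t else g 0 + dg 0 * t).
assert (HG : forall t, 0 <= t -> G t = g t).
{ intros t Ht; unfold G; destruct (Rle_dec 0 t); [reflexivity | contradiction]. }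
exists G; split; [exact HG|].
intros t Ht; apply is_derive_Reals; intros eps Heps.
destruct (H t Ht eps Heps) as [d [Hd Hlim]]; simpl in *; unfold Rdist in *.
assert (Hright : forall u, u <> 0 -> Rabs u < d -> 0 <= t + u ->
          Rabs ((G (t + u) - G t) / u - dg t) < eps).
{ intros u Hu Hud Hpos; rewrite !HG by assumption.
  replace u with (t + u - t) at 2 by ring.
  apply Hlim; repeat split; try lra.
  replace (t + u - t) with u by ring; exact Hud. }
assert (Hd' : 0 < if Rlt_dec 0 t then Rmin d t else d).
{ destruct (Rlt_dec 0 t); [apply Rmin_glb_lt; lra | exact Hd]. }
exists (mkposreal _ Hd'); simpl; intros u Hu.
destruct (Rlt_dec 0 t) as [Htp|Htp]; intros Hud.
- apply Rmin_Rgt in Hud; destruct Hud as [Hud1 Hud2].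
  apply Hright; try assumption.
  apply Rabs_def2 in Hud2; lra.
- destruct (Rle_dec 0 u) as [Hup|Hup]; [apply Hright; try assumption; lra|].
  assert (t = 0) by lra; subst t.
  rewrite (HG 0) by lra; unfold G.
  destruct (Rle_dec 0 (0 + u)); [exfalso; lra|].
  replace ((g 0 + dg 0 * (0 + u) - g 0) / u - dg 0) with 0 by (field; lra).
  rewrite Rabs_R0; exact Heps.
Qed.

Lemma is_derive_value (f : R -> R) (t l l' : R) :
  is_derive f t l -> l = l' -> is_derive f t l'.
Proof. intros H <-; exact H. Qed.

Lemma is_derive_continuity_pt (f : R -> R) (t l : R) :
  is_derive f t l -> continuity_pt f t.
Proof.
intros H; apply derivable_continuous_pt; exists l.
apply is_derive_Reals; exact H.
Qed.

(** Proves [is_derive F t l] when [F] is an expression in functions whose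
    derivatives at [t] are hypotheses; an equation of values is left. *)
Ltac derive_by_hyps :=
  auto_derive;
  [ repeat split; eexists; eauto
  | repeat match goal with
    | H : is_derive ?g ?t ?l |- _ =>
        change (Derive (fun x => g x) t) with (Derive g t);
        rewrite ?(is_derive_unique g t l H); clear H
    end ].

Lemma decreasing_from (U dU : R -> R) (t0 t : R) :
  t0 <= t ->
  (forall s, t0 <= s -> is_derive U s (dU s)) ->
  (forall s, t0 <= s -> dU s <= 0) -> U t <= U t0.
Proof.
intros Ht HU Hle.
destruct (MVT_gen U t0 t dU) as [c [Hc Heq]];
  rewrite ?Rmin_left, ?Rmax_right in * by assumption.
- intros s Hs; apply HU; lra.
- intros s Hs; apply (is_derive_continuity_pt U s (dU s)), HU; lra.
- assert (dU c <= 0) by (apply Hle; lra).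
  assert (dU c * (t - t0) <= 0) by nra.
  lra.
Qed.

(** Multiplying [W - c / a] by [exp (a t)] turns the differential inequality
    into monotonicity. *)
Lemma comparison (W dW : R -> R) (a c t0 t : R) :
  0 < a -> t0 <= t ->
  (forall s, t0 <= s -> is_derive W s (dW s)) ->
  (forall s, t0 <= s -> dW s <= - a * W s + c) ->
  W t <= (W t0 - c / a) * exp (- a * (t - t0)) + c / a.
Proof.
intros Ha Ht HW Hle.
assert (Hdec : (W t - c / a) * exp (a * (t - t0))
               <= (W t0 - c / a) * exp (a * (t0 - t0))).
{ apply (decreasing_from (fun s => (W s - c / a) * exp (a * (s - t0)))
    (fun s => (dW s + a * W s - c) * exp (a * (s - t0)))); [exact Ht| |].
  - intros s Hs; specialize (HW s Hs).
    derive_by_hyps; unfold Rminus; field; lra.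
  - intros s Hs; specialize (Hle s Hs).
    assert (He := exp_pos (a * (s - t0))); nra. }
replace (a * (t0 - t0)) with 0 in Hdec by ring; rewrite exp_0, Rmult_1_r in Hdec.
replace (- a * (t - t0)) with (- (a * (t - t0))) by ring; rewrite exp_Ropp.
assert (He := exp_pos (a * (t - t0))).
assert (W t - c / a <= (W t0 - c / a) * / exp (a * (t - t0))); [|lra].
apply (Rmult_le_reg_r (exp (a * (t - t0)))); [exact He|].
rewrite Rmult_assoc, Rinv_l by lra; lra.
Qed.

Lemma exp_neg_le_1 (a t : R) : 0 < a -> 0 <= t -> 0 < exp (- a * t) <= 1.
Proof.
intros Ha Ht; split; [apply exp_pos|].
rewrite <- exp_0; destruct (Req_dec (a * t) 0) as [H|H].
- right; f_equal; lra.
- left; apply exp_increasing; nra.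
Qed.

Lemma comparison_bound (W dW : R -> R) (a c t : R) :
  0 < a -> 0 <= c -> 0 <= W 0 -> 0 <= t -> smooth W dW ->
  (forall s, 0 <= s -> dW s <= - a * W s + c) ->
  W t <= W 0 + c / a.
Proof.
intros Ha Hc HW0 Ht HW Hle.
assert (H := comparison W dW a c 0 t Ha Ht HW Hle).
rewrite Rminus_0_r in H.
destruct (exp_neg_le_1 a t Ha Ht) as [He1 He2].
assert (0 <= c / a) by (apply Rle_mult_inv_pos; assumption).
nra.
Qed.

(** The initial value decays at the exact rate [a], as the bound on the
    estimation error requires. *)
Lemma forced_decay_bound (x F : R -> R) (a c t : R) :
  0 < a -> 0 <= t -> smooth x (fun s => - a * x s + F s) ->
  (forall s, 0 <= s -> Rabs (F s) <= c) ->
  Rabs (x t) <= Rabs (x 0) * exp (- a * t) + c / a.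
Proof.
intros Ha Ht Hx HF.
assert (Hc : 0 <= c).
{ specialize (HF 0 (Rle_refl 0)); assert (H := Rabs_pos (F 0)); lra. }
assert (Hca : 0 <= c / a) by (apply Rle_mult_inv_pos; assumption).
destruct (exp_neg_le_1 a t Ha Ht) as [He1 He2].
assert (H1 := comparison x _ a c 0 t Ha Ht Hx).
assert (H2 := comparison (fun s => - x s) (fun s => - (- a * x s + F s)) a c 0 t Ha Ht).
rewrite Rminus_0_r in *.
assert (G1 : x t <= (x 0 - c / a) * exp (- a * t) + c / a).
{ apply H1; intros s Hs; specialize (HF s Hs); apply Rabs_le_between in HF; lra. }
assert (G2 : - x t <= (- x 0 - c / a) * exp (- a * t) + c / a).
{ apply H2; intros s Hs.
  - specialize (Hx s Hs); derive_by_hyps; ring.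
  - specialize (HF s Hs); apply Rabs_le_between in HF; lra. }
assert (Ha1 := Rle_abs (x 0)); assert (Ha2 := Rle_abs (- x 0)).
rewrite Rabs_Ropp in Ha2.
apply Rabs_le_between; split; nra.
Qed.

(** * Limits at infinity *)

Lemma is_lim_infty_eps (g : R -> R) (l : R) :
  is_lim g p_infty l <->
  forall eps, 0 < eps -> exists T, 0 <= T /\
    forall t, T <= t -> Rabs (g t - l) <= eps.
Proof.
rewrite <- is_lim_spec; simpl; split.
- intros H eps Heps; destruct (H (mkposreal eps Heps)) as [T HT]; simpl in HT.
  exists (Rmax 0 T + 1); split.
  + assert (Hm := Rmax_l 0 T); lra.
  + intros t Ht; left; apply HT.
    assert (Hm := Rmax_r 0 T); lra.
- intros H eps.
  destruct (H (eps / 2)) as [T [_ HT]]; [apply is_pos_div_2|].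
  exists T; intros t Ht.
  assert (Hp := cond_pos eps).
  specialize (HT t (Rlt_le _ _ Ht)); lra.
Qed.

Lemma is_lim_infty_ext (g g' : R -> R) (l : R) :
  (forall t, 0 <= t -> g t = g' t) ->
  is_lim g p_infty l -> is_lim g' p_infty l.
Proof.
intros Heq; rewrite !is_lim_infty_eps; intros H eps Heps.
destruct (H eps Heps) as [T [HT0 HT]].
exists T; split; [exact HT0|].
intros t Ht; rewrite <- Heq by lra; exact (HT t Ht).
Qed.

Lemma is_lim_infty_sq_le (g W : R -> R) (l c : R) :
  0 < c -> (forall t, 0 <= t -> c * (g t - l) ^ 2 <= W t) ->
  is_lim W p_infty 0 -> is_lim g p_infty l.
Proof.
intros Hc Hle; rewrite !is_lim_infty_eps; intros H eps Heps.
destruct (H (c * eps ^ 2)) as [T [HT0 HT]];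
  [apply Rmult_lt_0_compat; [|apply pow_lt]; assumption|].
exists T; split; [exact HT0|]; intros t Ht.
specialize (HT t Ht); specialize (Hle t ltac:(lra)).
rewrite Rminus_0_r in HT; apply Rabs_le_between in HT.
assert (Hsq : (g t - l) ^ 2 <= eps ^ 2).
{ apply (Rmult_le_reg_l c); [exact Hc | lra]. }
apply Rabs_le_between; split; nra.
Qed.

Lemma is_lim_infty_sq (g : R -> R) :
  is_lim g p_infty 0 -> is_lim (fun t => g t ^ 2) p_infty 0.
Proof.
rewrite !is_lim_infty_eps; intros H eps Heps.
destruct (H (Rmin 1 eps)) as [T [HT0 HT]]; [apply Rmin_glb_lt; lra|].
exists T; split; [exact HT0|]; intros t Ht; specialize (HT t Ht).
rewrite Rminus_0_r in *; rewrite Rabs_pos_eq by apply pow2_ge_0.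
assert (H1 := Rmin_l 1 eps); assert (H2 := Rmin_r 1 eps).
assert (Hp := Rabs_pos (g t)); rewrite <- pow2_abs; nra.
Qed.

Lemma is_lim_infty_comb (g1 g2 : R -> R) (a b l1 l2 : R) :
  is_lim g1 p_infty l1 -> is_lim g2 p_infty l2 ->
  is_lim (fun t => a * g1 t + b * g2 t) p_infty (a * l1 + b * l2).
Proof.
intros H1 H2.
eapply is_lim_plus.
- apply (is_lim_scal_l g1 a p_infty l1 H1).
- apply (is_lim_scal_l g2 b p_infty l2 H2).
- reflexivity.
Qed.

Lemma comparison_to_zero (W dW g : R -> R) (a : R) :
  0 < a -> smooth W dW -> (forall t, 0 <= t -> 0 <= W t) ->
  (forall t, 0 <= t -> dW t <= - a * W t + g t) ->
  is_lim g p_infty 0 -> is_lim W p_infty 0.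
Proof.
intros Ha HW Hpos Hle; rewrite !is_lim_infty_eps; intros Hg eps Heps.
destruct (Hg (a * (eps / 2))) as [T [HT0 HT]]; [nra|].
set (K := 2 * W T / (a * eps)).
assert (HK : 0 <= K).
{ apply Rle_mult_inv_pos; [|nra]; specialize (Hpos T HT0); lra. }
exists (T + K); split; [lra|]; intros t Ht.
assert (H := comparison W dW a (a * (eps / 2)) T t Ha ltac:(lra)).
replace (a * (eps / 2) / a) with (eps / 2) in H by (field; lra).
rewrite Rminus_0_r, Rabs_pos_eq by (apply Hpos; lra).
assert (H' : W t <= (W T - eps / 2) * exp (- a * (t - T)) + eps / 2).
{ apply H.
  - intros s Hs; apply HW; lra.
  - intros s Hs; specialize (HT s Hs); rewrite Rminus_0_r in HT.
    apply Rabs_le_between in HT; specialize (Hle s ltac:(lra)); lra. }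
clear H.
assert (He0 := exp_pos (- a * (t - T))).
(* exp x >= 1 + x bounds the decaying factor by 1 / (a K) for t >= T + K *)
assert (He : W T * exp (- a * (t - T)) <= eps / 2).
{ replace (- a * (t - T)) with (- (a * (t - T))) by ring; rewrite exp_Ropp.
  assert (Hx : 1 + a * (t - T) <= exp (a * (t - T))) by apply exp_ineq1_le.
  assert (HKe : a * K * eps = 2 * W T) by (unfold K; field; lra).
  assert (He1 := exp_pos (a * (t - T))).
  apply (Rmult_le_reg_r (exp (a * (t - T)))); [exact He1|].
  rewrite Rmult_assoc, Rinv_l by lra.
  assert (a * K <= a * (t - T)) by nra.
  nra. }
nra.
Qed.

(** * The reference filter *)

(** For [x ^ 2], the equation gives [(x ^ 2)' <= - a x ^ 2 + g ^ 2 / a]. *)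
Lemma stable_first_order (x g : R -> R) (a G : R) :
  0 < a -> smooth x (fun t => - a * x t + g t) ->
  (forall t, 0 <= t -> Rabs (g t) <= G) -> is_lim g p_infty 0 ->
  (exists M, forall t, 0 <= t -> Rabs (x t) <= M) /\ is_lim x p_infty 0.
Proof.
intros Ha Hx HG Hg.
assert (Hsq : smooth (fun t => x t ^ 2)
                (fun t => 2 * x t * (- a * x t + g t))).
{ intros t Ht; specialize (Hx t Ht); derive_by_hyps; ring. }
split.
- exists (Rabs (x 0) + G / a); intros t Ht.
  assert (H := forced_decay_bound x g a G t Ha Ht Hx HG).
  destruct (exp_neg_le_1 a t Ha Ht) as [He1 He2].
  assert (Hp := Rabs_pos (x 0)); nra.
- apply (is_lim_infty_sq_le x (fun t => x t ^ 2) 0 1); [lra | intros; lra |].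
  apply (comparison_to_zero _ _ (fun t => g t ^ 2 / a) a Ha Hsq).
  + intros t _; apply pow2_ge_0.
  + intros t Ht.
    assert (Hy : 2 * x t * g t <= a * x t ^ 2 + g t ^ 2 / a); [|nra].
    apply (Rmult_le_reg_l a); [exact Ha|].
    replace (a * (a * x t ^ 2 + g t ^ 2 / a)) with (a ^ 2 * x t ^ 2 + g t ^ 2)
      by (field; lra).
    assert (Hs := pow2_ge_0 (a * x t - g t)); nra.
  + apply (is_lim_infty_ext (fun t => / a * g t ^ 2 + 0 * g t ^ 2)).
    * intros t _; field; lra.
    * replace (Finite 0) with (Finite (/ a * 0 + 0 * 0)) by (f_equal; ring).
      apply is_lim_infty_comb; apply is_lim_infty_sq; exact Hg.
Qed.

Definition bounded_reference (M yss : R) (r dr ddr : R -> R) : Prop :=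
  forall t, 0 <= t ->
    Rabs (r t - yss) <= M /\ Rabs (dr t) <= M /\ Rabs (ddr t) <= M.

(** With [m = r' + c (r - yss)], the double pole at [- c] splits into the two
    first-order filters [m' = - c m + c ^ 2 (ystar - yss)]
    and [(r - yss)' = - c (r - yss) + m]. *)
Lemma transient_tracks (ystar : R -> R) (yss c x10 x20 : R) (r dr ddr : R -> R) :
  reference_signal ystar yss -> 0 < c ->
  transient_process c ystar x10 x20 r dr ddr ->
  (exists M, bounded_reference M yss r dr ddr) /\
  is_lim r p_infty yss /\ is_lim dr p_infty 0 /\ is_lim ddr p_infty 0.
Proof.
intros (dy & ddy & [My HMy] & _ & _ & Hlim & _ & _) Hc (Hr & Hdr & Heq & _ & _).
destruct (smooth_extension _ _ Hr) as (r1 & Er & Sr).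
destruct (smooth_extension _ _ Hdr) as (r2 & Edr & Sdr).
set (s := fun t => r1 t - yss).
set (m := fun t => r2 t + c * s t).
set (g := fun t => c ^ 2 * (ystar t - yss)).
assert (Hg : forall t, 0 <= t -> Rabs (g t) <= c ^ 2 * (My + Rabs yss)).
{ intros t Ht; unfold g; rewrite Rabs_mult, (Rabs_pos_eq (c ^ 2)) by nra.
  apply Rmult_le_compat_l; [nra|].
  specialize (HMy t Ht); assert (Htri := Rabs_triang (ystar t) (- yss)).
  rewrite Rabs_Ropp in Htri; unfold Rminus; lra. }
assert (Lg : is_lim g p_infty 0).
{ replace (Finite 0) with (Finite (c ^ 2 * yss + - c ^ 2 * yss))
    by (f_equal; ring).
  apply (is_lim_infty_ext (fun t => c ^ 2 * ystar t + - c ^ 2 * yss)).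
  - intros t _; unfold g; ring.
  - apply is_lim_infty_comb; [exact Hlim | apply is_lim_const]. }
assert (Sm : smooth m (fun t => - c * m t + g t)).
{ intros t Ht.
  assert (H1 := Sr t Ht); assert (H2 := Sdr t Ht); unfold m, s, g.
  derive_by_hyps; rewrite (Heq t Ht), <- (Edr t Ht), <- (Er t Ht); ring. }
destruct (stable_first_order m g c _ Hc Sm Hg Lg) as [[Mm HMm] Lm].
assert (Ss : smooth s (fun t => - c * s t + m t)).
{ intros t Ht; assert (H1 := Sr t Ht); unfold m, s.
  derive_by_hyps; rewrite (Edr t Ht); ring. }
destruct (stable_first_order s m c _ Hc Ss HMm Lm) as [[Ms HMs] Ls].
assert (Dr : forall t, 0 <= t -> dr t = 1 * m t + - c * s t).
{ intros t Ht; unfold m; rewrite (Edr t Ht); ring. }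
assert (DDr : forall t, 0 <= t -> ddr t = - 2 * c * dr t + 1 * (- c ^ 2 * s t + 1 * g t)).
{ intros t Ht; rewrite (Heq t Ht); unfold g, s; rewrite (Er t Ht); ring. }
assert (Ldr : is_lim dr p_infty 0).
{ apply (is_lim_infty_ext (fun t => 1 * m t + - c * s t)).
  - intros t Ht; symmetry; exact (Dr t Ht).
  - replace (Finite 0) with (Finite (1 * 0 + - c * 0)) by (f_equal; ring).
    apply is_lim_infty_comb; assumption. }
split; [|split; [|split; [exact Ldr|]]].
- exists (Ms + (Mm + c * Ms) + (2 * c * (Mm + c * Ms) + c ^ 2 * Ms
          + c ^ 2 * (My + Rabs yss))).
  intros t Ht.
  specialize (HMs t Ht); specialize (HMm t Ht); specialize (Hg t Ht).
  assert (Hdb : Rabs (dr t) <= Mm + c * Ms).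
  { rewrite (Dr t Ht).
    apply Rabs_le_between in HMs; apply Rabs_le_between in HMm.
    apply Rabs_le_between; split; nra. }
  assert (Hddb : Rabs (ddr t) <= 2 * c * (Mm + c * Ms) + c ^ 2 * Ms
          + c ^ 2 * (My + Rabs yss)).
  { rewrite (DDr t Ht).
    apply Rabs_le_between in HMs; apply Rabs_le_between in Hdb;
    apply Rabs_le_between in Hg.
    assert (Hc2 : 0 < c ^ 2) by nra.
    apply Rabs_le_between; split; nra. }
  assert (P1 := Rabs_pos (s t)); assert (P2 := Rabs_pos (dr t));
  assert (P3 := Rabs_pos (ddr t)).
  unfold s in *; rewrite (Er t Ht) in *; repeat split; lra.
- apply (is_lim_infty_ext (fun t => 1 * s t + 1 * yss)).
  + intros t Ht; unfold s; rewrite (Er t Ht); ring.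
  + replace (Finite yss) with (Finite (1 * 0 + 1 * yss)) by (f_equal; ring).
    apply is_lim_infty_comb; [exact Ls | apply is_lim_const].
- apply (is_lim_infty_ext (fun t => - 2 * c * dr t + 1 * (- c ^ 2 * s t + 1 * g t))).
  + intros t Ht; symmetry; exact (DDr t Ht).
  + replace (Finite 0) with (Finite (- 2 * c * 0 + 1 * (- c ^ 2 * 0 + 1 * 0)))
      by (f_equal; ring).
    apply is_lim_infty_comb; [exact Ldr|].
    apply is_lim_infty_comb; assumption.
Qed.

(** The deviation of a transient from its setpoint is determined by its
    velocity, being [- ∫_t^∞ r']. *)
Lemma deviation_determined_by_velocity (r r' dr : R -> R) (l l' : R) :
  deriv_nonneg r dr -> deriv_nonneg r' dr ->
  is_lim r p_infty l -> is_lim r' p_infty l' ->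
  forall t, 0 <= t -> r t - l = r' t - l'.
Proof.
intros Hr Hr' Hl Hl' t Ht.
destruct (smooth_extension _ _ Hr) as (r1 & Er & Sr).
destruct (smooth_extension _ _ Hr') as (r2 & Er' & Sr').
assert (Hconst : forall s, t <= s -> r s - r' s = r t - r' t).
{ intros s Hs; rewrite <- !Er, <- !Er' by lra; apply Rle_antisym.
  - apply (decreasing_from (fun s => r1 s - r2 s) (fun _ => 0)); [exact Hs | | intros; lra].
    intros u Hu; assert (H1 := Sr u ltac:(lra)); assert (H2 := Sr' u ltac:(lra)).
    derive_by_hyps; ring.
  - apply Ropp_le_cancel.
    apply (decreasing_from (fun s => - (r1 s - r2 s)) (fun _ => 0)); [exact Hs | | intros; lra].
    intros u Hu; assert (H1 := Sr u ltac:(lra)); assert (H2 := Sr' u ltac:(lra)).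
    derive_by_hyps; ring. }
assert (L1 : is_lim (fun s => r s - r' s) p_infty (l - l'))
  by (apply is_lim_minus'; assumption).
assert (L2 : is_lim (fun s => r s - r' s) p_infty (r t - r' t)).
{ apply is_lim_infty_eps; intros eps Heps; exists t; split; [exact Ht|].
  intros s Hs; rewrite (Hconst s Hs), Rminus_diag, Rabs_R0; lra. }
apply is_lim_unique in L1; apply is_lim_unique in L2.
rewrite L1 in L2; injection L2; lra.
Qed.

(** * The threshold on the observer bandwidth *)

(** [damping] and [stiffness] are the smallest values over the class of the
    coefficients [kd - ∂h/∂x2] and [kp - ∂h/∂x1] of the characteristic
    polynomial of the linearized loop, whose constant term is [ki = w kap];
    [hurwitz] is the margin of the Routh-Hurwitz inequality there. *)
Definition damping (L2 kad w : R) : R := w + kad - L2.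
Definition stiffness (L1 kap kad w : R) : R := kap - L1 + w * kad.
Definition hurwitz (L1 L2 kap kad w : R) : R :=
  damping L2 kad w * stiffness L1 kap kad w - w * kap.

Definition omega_poly (L1 L2 kap kad w : R) : R :=
  hurwitz L1 L2 kap kad w ^ 2 - L2 ^ 2 * damping L2 kad w * (w * kap).

Lemma Omega_root (L1 L2 kap kad w : R) :
  Omega L1 L2 kap kad w <-> omega_poly L1 L2 kap kad w = 0.
Proof.
unfold Omega, omega_poly, hurwitz, damping, stiffness.
assert (E : forall a b : R, a = b -> (a = 0 <-> b = 0)) by (intros a b ->; tauto).
apply E; ring.
Qed.

Lemma quartic_positive (n0 n1 n2 n3 n4 w : R) :
  0 < n0 ->
  1 + (Rabs n1 + Rabs n2 + Rabs n3 + Rabs n4) / n0 < w ->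
  0 < n0 * w ^ 4 + n1 * w ^ 3 + n2 * w ^ 2 + n3 * w + n4.
Proof.
intros H0 Hw.
set (S := Rabs n1 + Rabs n2 + Rabs n3 + Rabs n4) in *.
assert (HS : 0 <= S).
{ unfold S; assert (A1 := Rabs_pos n1); assert (A2 := Rabs_pos n2);
  assert (A3 := Rabs_pos n3); assert (A4 := Rabs_pos n4); lra. }
assert (HSn : 0 <= S / n0) by (apply Rle_mult_inv_pos; assumption).
assert (H1 : 1 < w) by lra.
assert (HSw : S < n0 * w).
{ replace S with (n0 * (S / n0)) by (field; lra).
  apply Rmult_lt_compat_l; lra. }
assert (W3 : 1 <= w ^ 3) by (apply pow_R1_Rle; lra).
assert (W2 : w ^ 2 <= w ^ 3) by (apply Rle_pow; [lra | auto]).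
assert (W1 : w <= w ^ 3).
{ replace w with (w ^ 1) at 1 by ring; apply Rle_pow; [lra | auto]. }
assert (B : forall n x, 0 <= x <= w ^ 3 -> - (Rabs n * w ^ 3) <= n * x).
{ intros n x Hx; assert (A := Rle_abs (- n)); rewrite Rabs_Ropp in A.
  assert (A' := Rabs_pos n); nra. }
assert (B1 := B n1 (w ^ 3) ltac:(lra)).
assert (B2 := B n2 (w ^ 2) ltac:(nra)).
assert (B3 := B n3 w ltac:(lra)).
assert (B4 := B n4 1 ltac:(lra)).
assert (HSw3 : S * w ^ 3 < n0 * w * w ^ 3) by (apply Rmult_lt_compat_r; lra).
unfold S in HSw3.
replace (n0 * w ^ 4) with (n0 * w * w ^ 3) by ring.
lra.
Qed.

Section Threshold.

Variables L1 L2 kap kad : R.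
Hypothesis hL1 : 0 < L1.
Hypothesis hL2 : 0 < L2.
Hypothesis hkap : 0 < kap.
Hypothesis hkad : 0 < kad.

Let A := damping L2 kad.
Let B := stiffness L1 kap kad.
Let Q := hurwitz L1 L2 kap kad.
Let P := omega_poly L1 L2 kap kad.
Let wstar := omega_star L1 L2 kap kad.

Lemma omega_poly_eventually_pos :
  exists W, forall w, W < w -> 0 < P w.
Proof.
eexists; intros w Hw.
assert (H := quartic_positive (kad ^ 2)
  (2 * kad * (kad * (kad - L2) - L1))
  (2 * kad * (kap - L1) * (kad - L2)
            + (kad * (kad - L2) - L1) ^ 2 - L2 ^ 2 * kap)
  (2 * (kad * (kad - L2) - L1) * (kap - L1) * (kad - L2)
            - L2 ^ 2 * kap * (kad - L2))
  ((kap - L1) ^ 2 * (kad - L2) ^ 2) w ltac:(nra) Hw).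
unfold P, omega_poly, hurwitz, damping, stiffness.
eapply Rlt_le_trans; [exact H | right; ring].
Qed.

Lemma omega_poly_continuity : continuity P.
Proof.
intros w; apply derivable_continuous_pt.
unfold P, omega_poly, hurwitz, damping, stiffness; reg.
Qed.

Lemma hurwitz_continuity : continuity Q.
Proof.
intros w; apply derivable_continuous_pt.
unfold Q, hurwitz, damping, stiffness; reg.
Qed.

Lemma omega_star_lower_bounds :
  0 <= wstar /\ 0 <= A wstar /\ 0 <= B wstar.
Proof.
unfold wstar, omega_star; set (o := omega_bar L1 L2 kap kad).
assert (H0 := Rmax_l 0 (Rmax ((L1 - kap) / kad) (Rmax (L2 - kad) o))).
assert (H1 := Rmax_r 0 (Rmax ((L1 - kap) / kad) (Rmax (L2 - kad) o))).
assert (H2 := Rmax_l ((L1 - kap) / kad) (Rmax (L2 - kad) o)).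
assert (H3 := Rmax_r ((L1 - kap) / kad) (Rmax (L2 - kad) o)).
assert (H4 := Rmax_l (L2 - kad) o).
set (w := Rmax 0 _) in *.
assert (H5 : L1 - kap <= w * kad).
{ replace (L1 - kap) with ((L1 - kap) / kad * kad) by (field; lra).
  apply Rmult_le_compat_r; lra. }
unfold A, B, damping, stiffness; lra.
Qed.

Lemma omega_poly_root_le (w : R) : 0 < w -> P w = 0 -> w <= wstar.
Proof.
intros Hw HP.
assert (Hroot : Omega L1 L2 kap kad w) by (apply Omega_root; exact HP).
apply Rle_trans with (omega_bar L1 L2 kap kad).
- unfold omega_bar.
  destruct (Lub_Rbar_correct (Omega L1 L2 kap kad)) as [Hub Hleast].
  destruct omega_poly_eventually_pos as [W HW].
  assert (HlubW : Rbar_le (Lub_Rbar (Omega L1 L2 kap kad)) W).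
  { apply Hleast; intros v Hv; simpl.
    apply Omega_root in Hv.
    destruct (Rle_or_lt v W) as [H|H]; [exact H|].
    specialize (HW v H); unfold P in HW; lra. }
  specialize (Hub w Hroot).
  destruct (Lub_Rbar (Omega L1 L2 kap kad)) as [m| |]; simpl in *;
    [|contradiction|contradiction].
  destruct (Rlt_dec 0 m); lra.
- unfold wstar, omega_star.
  eapply Rle_trans; [|apply Rmax_r].
  eapply Rle_trans; [|apply Rmax_r].
  apply Rmax_r.
Qed.

(** Beyond the last root the quartic [hurwitz ^ 2 - L2 ^ 2 A C] is positive; and
    [hurwitz], which is eventually positive, cannot vanish there, because the
    quartic is negative wherever [hurwitz] vanishes. *)
Lemma stability_above_threshold (w : R) :
  wstar < w ->
  0 < A w /\ 0 < B w /\ 0 < Q w /\ L2 ^ 2 * (A w * (w * kap)) < Q w ^ 2.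
Proof.
intros Hw.
destruct omega_star_lower_bounds as [H0 [HA HB]].
assert (HAB : forall v, wstar < v -> 0 < A v /\ 0 < B v).
{ intros v Hv; unfold A, B, damping, stiffness in *.
  assert (wstar * kad < v * kad) by (apply Rmult_lt_compat_r; assumption).
  lra. }
assert (HP : forall v, wstar < v -> 0 < P v).
{ intros v Hv; destruct (Rlt_or_le 0 (P v)) as [H|H]; [exact H|exfalso].
  destruct omega_poly_eventually_pos as [W HW].
  set (v' := Rmax v W + 1).
  assert (Hv1 := Rmax_l v W); assert (Hv2 := Rmax_r v W).
  assert (HPv' : 0 < P v') by (apply HW; unfold v'; lra).
  destruct (IVT_gen P v v' 0 omega_poly_continuity) as [x [Hx HPx]].
  - rewrite Rmin_left, Rmax_right by lra; lra.
  - rewrite Rmin_left in Hx by (unfold v'; lra).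
    assert (x <= wstar) by (apply omega_poly_root_le; [lra | exact HPx]); lra. }
assert (HPQ : forall v, P v = Q v ^ 2 - L2 ^ 2 * (A v * (v * kap))).
{ intros v; unfold P, Q, A, omega_poly; ring. }
assert (HQ0 : forall v, wstar < v -> Q v <> 0).
{ intros v Hv HQ; specialize (HP v Hv); rewrite HPQ, HQ in HP.
  assert (0 < A v * (v * kap)).
  { apply Rmult_lt_0_compat; [apply (HAB v Hv) | apply Rmult_lt_0_compat; lra]. }
  assert (0 < L2 ^ 2 * (A v * (v * kap)))
    by (apply Rmult_lt_0_compat; [apply pow_lt; exact hL2 | assumption]).
  nra. }
destruct (HAB w Hw) as [HAw HBw].
assert (HQ : 0 < Q w).
{ destruct (Rlt_or_le 0 (Q w)) as [H|H]; [exact H|exfalso].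
  (* s is chosen so that the quadratic term kad s ^ 2 wins at w + s *)
  set (s := 1 + (w + 1) * kap / kad).
  assert (Hs : 1 <= s).
  { unfold s; assert (0 <= (w + 1) * kap / kad); [|lra].
    apply Rle_mult_inv_pos; nra. }
  assert (Hks : kad * s = kad + (w + 1) * kap) by (unfold s; field; lra).
  assert (HQs : 0 < Q (w + s)).
  { replace (Q (w + s)) with ((A w + s) * (B w + kad * s) - (w + s) * kap)
      by (unfold Q, hurwitz, A, B, damping, stiffness; ring).
    assert (E : kad * s * s = (kad + (w + 1) * kap) * s) by (rewrite Hks; ring).
    assert (0 <= A w * B w) by nra.
    assert (0 <= A w * (kad * s)) by (apply Rmult_le_pos; [lra | nra]).
    assert (0 <= s * B w) by nra.
    assert (w * kap <= w * kap * s) by (assert (0 <= w * kap) by nra; nra).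
    nra. }
  destruct (IVT_gen Q w (w + s) 0 hurwitz_continuity) as [x [Hx HQx]].
  - rewrite Rmin_left, Rmax_right by lra; lra.
  - rewrite Rmin_left in Hx by lra.
    apply (HQ0 x); [lra | exact HQx]. }
specialize (HP w Hw); rewrite HPQ in HP; repeat split; try assumption; lra.
Qed.
End Threshold.

Lemma nonneg_of_small_perturbation (a b : R) :
  (forall s, 0 < s <= 1 -> 0 <= a + b * s) -> 0 <= a.
Proof.
intros H; destruct (Rle_or_lt 0 a) as [Ha|Ha]; [exact Ha|exfalso].
set (s := - a / (- a + 1 + Rabs b)).
assert (Hb := Rabs_pos b).
assert (Hs : s * (- a + 1 + Rabs b) = - a) by (unfold s; field; lra).
assert (Hs0 : 0 < s) by (apply Rdiv_lt_0_compat; lra).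
assert (Hs1 : s <= 1) by nra.
specialize (H s (conj Hs0 Hs1)).
assert (Hb' := Rle_abs b); nra.
Qed.

(** By continuity, the two inequalities that hold above the threshold forbid
    either coefficient to vanish at the threshold itself: the closed loop
    degenerates only through the integral gain, when the threshold is [0]. *)
Lemma threshold_nondegenerate (L1 L2 kap kad : R) :
  0 < L1 -> 0 < L2 -> 0 < kap -> 0 < kad ->
  let wstar := omega_star L1 L2 kap kad in
  0 <= wstar /\ 0 < damping L2 kad wstar /\ 0 < stiffness L1 kap kad wstar.
Proof.
intros hL1 hL2 hkap hkad wstar.
destruct (omega_star_lower_bounds L1 L2 kap kad hkad) as [H0 [HA HB]].
fold wstar in H0, HA, HB.
assert (Hst : forall s, 0 < s <= 1 ->
   0 < hurwitz L1 L2 kap kad (wstar + s) /\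
   L2 ^ 2 * (damping L2 kad (wstar + s) * ((wstar + s) * kap))
     < hurwitz L1 L2 kap kad (wstar + s) ^ 2).
{ intros s Hs; apply stability_above_threshold; try assumption.
  unfold wstar in *; lra. }
split; [exact H0|].
set (a := damping L2 kad wstar) in *; set (b := stiffness L1 kap kad wstar) in *.
assert (Ea : forall s, damping L2 kad (wstar + s) = a + s)
  by (intros s; unfold a, damping; ring).
assert (EQ : forall s, hurwitz L1 L2 kap kad (wstar + s)
             = (a + s) * (b + s * kad) - (wstar + s) * kap)
  by (intros s; unfold hurwitz, a, b, damping, stiffness; ring).
destruct (Req_dec wstar 0) as [Hw|Hw].
- assert (Eb : b = kap - L1) by (unfold b, stiffness; rewrite Hw; ring).
  rewrite Hw in *.
  assert (Ha : 0 < a).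
  { destruct HA as [HA|HA]; [exact HA|exfalso].
    assert (0 <= - L1); [|lra].
    apply (nonneg_of_small_perturbation _ kad); intros s Hs.
    destruct (Hst s Hs) as [HQ _]; rewrite EQ, <- HA, Eb in HQ.
    apply Rlt_le, (Rmult_lt_reg_l s); nra. }
  split; [exact Ha|].
  destruct HB as [HB|HB]; [exact HB|exfalso].
  assert (Hpos : 0 < L2 ^ 2 * (a * kap)).
  { apply Rmult_lt_0_compat; [apply pow_lt|apply Rmult_lt_0_compat]; assumption. }
  assert (0 <= - (L2 ^ 2 * (a * kap))); [|lra].
  apply (nonneg_of_small_perturbation _ ((kad + Rabs (kad * a - kap)) ^ 2)).
  intros s Hs.
  destruct (Hst s Hs) as [_ HQ]; rewrite EQ, Ea, <- HB in HQ.
  set (u := kad * s + (kad * a - kap)).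
  replace ((a + s) * (0 + s * kad) - (0 + s) * kap) with (s * u) in HQ
    by (unfold u; ring).
  assert (Hu2 : u ^ 2 <= (kad + Rabs (kad * a - kap)) ^ 2).
  { apply pow_maj_Rabs; unfold u.
    eapply Rle_trans; [apply Rabs_triang|].
    apply Rplus_le_compat_r; rewrite Rabs_pos_eq; nra. }
  assert (Hsu : L2 ^ 2 * ((a + s) * kap) <= s * u ^ 2).
  { apply Rlt_le, (Rmult_lt_reg_l s); [lra|].
    replace (s * (L2 ^ 2 * ((a + s) * kap)))
      with (L2 ^ 2 * ((a + s) * ((0 + s) * kap))) by ring.
    replace (s * (s * u ^ 2)) with ((s * u) ^ 2) by ring; exact HQ. }
  assert (L2 ^ 2 * (a * kap) <= L2 ^ 2 * ((a + s) * kap)).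
  { apply Rmult_le_compat_l; [apply pow2_ge_0 | apply Rmult_le_compat_r; lra]. }
  nra.
- assert (HQ : 0 <= a * b - wstar * kap).
  { apply (nonneg_of_small_perturbation _ (a * kad + b + kad)); intros s Hs.
    destruct (Hst s Hs) as [HQ _]; rewrite EQ in HQ.
    assert (s * (s * kad) <= 1 * (s * kad)) by (apply Rmult_le_compat_r; nra).
    nra. }
  assert (0 < wstar * kap) by (apply Rmult_lt_0_compat; lra).
  split; apply Rnot_le_lt; intros Hle; nra.
Qed.

(** * A dissipation margin that is uniform up to the threshold *)

(** Linearized damping ranges over [A + theta] with [0 <= theta <= 2 L].  The
    form is the dissipation rate, in the rates of the two plant coordinates, of
    the Lyapunov function [energy] below with multiplier [mu], whose quadratic
    part is centred at the damping [A + m]. *)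
Definition dissipative (L A B C mu m lam : R) : Prop :=
  forall theta p q, 0 <= theta <= 2 * L ->
    lam * (p ^ 2 + q ^ 2)
    <= (A + theta - mu) * q ^ 2 + (mu * B - C) * p ^ 2 + mu * (theta - m) * (p * q).

Lemma dissipative_weaken (L A B C mu m lam lam' : R) :
  lam' <= lam -> dissipative L A B C mu m lam -> dissipative L A B C mu m lam'.
Proof.
intros Hle H theta p q Ht; eapply Rle_trans; [|exact (H theta p q Ht)].
apply Rmult_le_compat_r; [|exact Hle].
assert (Hp := pow2_ge_0 p); assert (Hq := pow2_ge_0 q); lra.
Qed.

Lemma quadratic_form_margin (a b c s p q : R) :
  0 < a -> 0 < c -> 0 <= s <= 1 -> b ^ 2 <= (1 - s) * (a * c) ->
  s / 2 * (a * q ^ 2 + c * p ^ 2) <= a * q ^ 2 + c * p ^ 2 + 2 * b * (p * q).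
Proof.
intros Ha Hc Hs Hb.
set (a' := (1 - s / 2) * a); set (c' := (1 - s / 2) * c).
assert (Ha' : 0 < a') by (unfold a'; nra).
assert (Hac : 0 < a * c) by nra.
assert (Hb' : b ^ 2 <= a' * c').
{ replace (a' * c') with ((1 - s / 2) ^ 2 * (a * c)) by (unfold a', c'; ring).
  eapply Rle_trans; [exact Hb|]; apply Rmult_le_compat_r; nra. }
assert (H : 0 <= a' * q ^ 2 + c' * p ^ 2 + 2 * b * (p * q)); [|unfold a', c' in H; lra].
apply (Rmult_le_reg_l a'); [exact Ha'|].
replace (a' * (a' * q ^ 2 + c' * p ^ 2 + 2 * b * (p * q)))
  with ((a' * q + b * p) ^ 2 + (a' * c' - b ^ 2) * p ^ 2) by ring.
assert (H1 := pow2_ge_0 (a' * q + b * p)); assert (H2 := pow2_ge_0 p); nra.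
Qed.

(** With [m = L], the centre of the damping range, the multiplier
    [mu = 2 A C / (A B + C)] is optimal, and it makes the form positive exactly
    when [L ^ 2 A C < (A B - C) ^ 2].  When equality holds the form degenerates
    at the end [theta = 0] only, so that moving [m] a little towards that end
    leaves a margin. *)
Lemma dissipative_uniform (L k K : R) :
  0 < L -> 0 < k -> k <= K ->
  exists lam, 0 < lam /\
  forall A B C, k <= A <= K -> k <= B <= K -> k <= C <= K ->
    0 < A * B - C -> L ^ 2 * (A * C) <= (A * B - C) ^ 2 ->
    exists mu m, 0 <= m <= L /\ dissipative L A B C mu m lam.
Proof.
intros HL Hk HkK.
assert (HK : 0 < K) by lra.
assert (HK3 : 0 < 4 * K ^ 3) by (assert (H := pow_lt K 3 HK); lra).
assert (Hk2 : 0 < k ^ 2) by (apply pow_lt; exact Hk).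
set (s := Rmin (1 / 2) (k ^ 2 / (4 * K ^ 3))).
assert (Hs0 : 0 < s)
  by (unfold s; apply Rmin_glb_lt; [lra | apply Rdiv_lt_0_compat; assumption]).
assert (Hs1 : s <= 1 / 2) by apply Rmin_l.
assert (Hs2 : s * (4 * K ^ 3) <= k ^ 2).
{ replace (k ^ 2) with (k ^ 2 / (4 * K ^ 3) * (4 * K ^ 3)) by (field; lra).
  apply Rmult_le_compat_r; [lra | apply Rmin_r]. }
assert (HKK : 0 < K ^ 2 + K) by nra.
exists (s / 2 * (k ^ 2 * L) / (K ^ 2 + K)); split.
{ apply Rdiv_lt_0_compat; [|exact HKK].
  apply Rmult_lt_0_compat; [lra | apply Rmult_lt_0_compat; assumption]. }
intros A B C HA HB HC HQ0 HQ.
set (Q := A * B - C) in *; set (S := A * B + C).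
assert (HAC : k ^ 2 <= A * C) by nra.
assert (HQk : L * k <= Q).
{ apply Rnot_lt_le; intros Hlt.
  assert (HL2 : 0 < L ^ 2) by (apply pow_lt; exact HL).
  assert (L ^ 2 * k ^ 2 <= L ^ 2 * (A * C)) by (apply Rmult_le_compat_l; lra).
  assert (Q ^ 2 < (L * k) ^ 2) by nra.
  replace ((L * k) ^ 2) with (L ^ 2 * k ^ 2) in * by ring; lra. }
assert (HSk : k <= S) by (unfold S; nra).
assert (HSK : S <= K ^ 2 + K).
{ unfold S; assert (A * B <= K * K) by (apply Rmult_le_compat; lra); nra. }
assert (HACQ : k * (L * k) <= A * Q) by (apply Rmult_le_compat; nra).
assert (HCQ : k * (L * k) <= C * Q) by (apply Rmult_le_compat; nra).
assert (HLk : 0 < k * (L * k)) by (apply Rmult_lt_0_compat; nra).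
exists (2 * (A * C) / S), (L * (1 - s)); split; [nra|].
intros theta p q Hth.
set (m := L * (1 - s)).
assert (Hb : (A * C * (theta - m)) ^ 2 <= (1 - s) * ((A * Q + theta * S) * (C * Q))).
{ assert (Hsq : (theta - m) ^ 2 <= m ^ 2 + 2 * (L * s) * theta) by (unfold m; nra).
  assert (H1 : A ^ 2 * C * m ^ 2 <= (1 - s) * (A * Q ^ 2)).
  { replace (A ^ 2 * C * m ^ 2) with ((1 - s) ^ 2 * (A * (L ^ 2 * (A * C))))
      by (unfold m; ring).
    assert (A * (L ^ 2 * (A * C)) <= A * Q ^ 2) by (apply Rmult_le_compat_l; lra).
    assert (0 <= A * Q ^ 2) by (apply Rmult_le_pos; [lra | apply pow2_ge_0]).
    apply Rle_trans with ((1 - s) ^ 2 * (A * Q ^ 2)).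
    - apply Rmult_le_compat_l; [apply pow2_ge_0 | assumption].
    - apply Rmult_le_compat_r; [assumption | nra]. }
  assert (H2 : A ^ 2 * C * (2 * (L * s)) <= (1 - s) * (S * Q)).
  { assert (HA2 : A ^ 2 * C <= K ^ 3).
    { replace (K ^ 3) with (K ^ 2 * K) by ring.
      apply Rmult_le_compat; [apply pow2_ge_0 | lra | | lra].
      apply pow_incr; lra. }
    assert (HSQ : k * (L * k) <= S * Q) by (apply Rmult_le_compat; nra).
    assert (A ^ 2 * C * (2 * (L * s)) <= K ^ 3 * (2 * (L * s)))
      by (apply Rmult_le_compat_r; [nra | exact HA2]).
    assert (L * (s * (4 * K ^ 3)) <= L * k ^ 2) by (apply Rmult_le_compat_l; lra).
    nra. }
  assert (H3 : A ^ 2 * C * (theta - m) ^ 2 <= (1 - s) * (A * Q ^ 2 + theta * (S * Q))).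
  { assert (HA2C : 0 <= A ^ 2 * C) by (apply Rmult_le_pos; [apply pow2_ge_0 | lra]).
    assert (A ^ 2 * C * (theta - m) ^ 2
            <= A ^ 2 * C * (m ^ 2 + 2 * (L * s) * theta))
      by (apply Rmult_le_compat_l; assumption).
    assert (A ^ 2 * C * (2 * (L * s)) * theta <= (1 - s) * (S * Q) * theta)
      by (apply Rmult_le_compat_r; lra).
    lra. }
  assert (C * (A ^ 2 * C * (theta - m) ^ 2)
          <= C * ((1 - s) * (A * Q ^ 2 + theta * (S * Q))))
    by (apply Rmult_le_compat_l; lra).
  lra. }
assert (Hform := quadratic_form_margin (A * Q + theta * S) (A * C * (theta - m))
          (C * Q) s p q ltac:(nra) ltac:(lra) ltac:(lra) Hb).
assert (Hp := pow2_ge_0 p); assert (Hq := pow2_ge_0 q).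
apply (Rmult_le_reg_l S); [lra|].
replace (S * ((A + theta - 2 * (A * C) / S) * q ^ 2
              + (2 * (A * C) / S * B - C) * p ^ 2
              + 2 * (A * C) / S * (theta - m) * (p * q)))
  with ((A * Q + theta * S) * q ^ 2 + C * Q * p ^ 2 + 2 * (A * C * (theta - m)) * (p * q))
  by (unfold S, Q; field; fold S; lra).
eapply Rle_trans; [|exact Hform].
apply Rle_trans with (s / 2 * (k ^ 2 * L) * (p ^ 2 + q ^ 2)).
- replace (S * (s / 2 * (k ^ 2 * L) / (K ^ 2 + K) * (p ^ 2 + q ^ 2)))
    with (S / (K ^ 2 + K) * (s / 2 * (k ^ 2 * L) * (p ^ 2 + q ^ 2))) by (field; lra).
  rewrite <- (Rmult_1_l (s / 2 * (k ^ 2 * L) * (p ^ 2 + q ^ 2))) at 2.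
  apply Rmult_le_compat_r.
  + apply Rmult_le_pos; [|lra].
    apply Rmult_le_pos; [lra|]; apply Rmult_le_pos; lra.
  + apply (Rmult_le_reg_r (K ^ 2 + K)); [exact HKK|].
    unfold Rdiv; rewrite Rmult_assoc, Rinv_l by lra; lra.
- rewrite Rmult_assoc; apply Rmult_le_compat_l; [lra|].
  assert (0 <= theta * S) by nra.
  assert (k ^ 2 * L * q ^ 2 <= (A * Q + theta * S) * q ^ 2)
    by (apply Rmult_le_compat_r; [exact Hq | nra]).
  assert (k ^ 2 * L * p ^ 2 <= C * Q * p ^ 2)
    by (apply Rmult_le_compat_r; [exact Hp | nra]).
  lra.
Qed.

(** The multiplier [2 A C / (A B + C)] tends to [0] with [C], and the margin
    with it.  A fixed small multiplier satisfies [C < mu B] as soon as [C] is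
    small. *)
Lemma dissipative_small_integral (L k : R) :
  0 < L -> 0 < k ->
  exists c lam, 0 < c /\ 0 < lam /\
  forall A B C, k <= A -> k <= B -> C <= c ->
    exists mu, dissipative L A B C mu L lam.
Proof.
intros HL Hk.
assert (HL2 : 0 < 2 * L ^ 2) by (assert (H := pow_lt L 2 HL); lra).
set (mu := Rmin (k / 2) (k ^ 2 / (2 * L ^ 2))).
assert (Hmu : 0 < mu).
{ unfold mu; apply Rmin_glb_lt; [lra | apply Rdiv_lt_0_compat; [|exact HL2]].
  apply pow_lt; exact Hk. }
assert (Hmu1 : mu <= k / 2) by apply Rmin_l.
assert (Hmu2 : mu * (2 * L ^ 2) <= k ^ 2).
{ replace (k ^ 2) with (k ^ 2 / (2 * L ^ 2) * (2 * L ^ 2)) by (field; lra).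
  apply Rmult_le_compat_r; [lra | apply Rmin_r]. }
assert (Hmuk : 0 < mu * k) by nra.
set (lam := Rmin (k / 2) (mu * k / 2) / 4).
exists (mu * k / 2), lam; split; [lra|split].
{ unfold lam; assert (0 < Rmin (k / 2) (mu * k / 2)) by (apply Rmin_glb_lt; lra); lra. }
intros A B C HA HB HC; exists mu; intros theta p q Hth.
assert (Hb : (mu * (theta - L) / 2) ^ 2 <= (1 - 1 / 2) * (k / 2 * (mu * k / 2))).
{ assert ((theta - L) ^ 2 <= L ^ 2) by nra.
  replace ((mu * (theta - L) / 2) ^ 2) with (mu * (mu * (theta - L) ^ 2) / 4) by field.
  assert (mu * (theta - L) ^ 2 <= mu * L ^ 2) by (apply Rmult_le_compat_l; lra).
  assert (mu * (mu * (theta - L) ^ 2) <= mu * (k ^ 2 / 2))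
    by (apply Rmult_le_compat_l; lra).
  lra. }
assert (Hform := quadratic_form_margin (k / 2) _ (mu * k / 2) (1 / 2) p q
          ltac:(lra) ltac:(lra) ltac:(lra) Hb).
assert (H1 := Rmin_l (k / 2) (mu * k / 2)); assert (H2 := Rmin_r (k / 2) (mu * k / 2)).
assert (Hp := pow2_ge_0 p); assert (Hq := pow2_ge_0 q).
assert (k / 2 * q ^ 2 <= (A + theta - mu) * q ^ 2)
  by (apply Rmult_le_compat_r; lra).
assert (mu * k / 2 * p ^ 2 <= (mu * B - C) * p ^ 2).
{ apply Rmult_le_compat_r; [exact Hp|].
  assert (mu * k <= mu * B) by (apply Rmult_le_compat_l; lra); lra. }
assert (lam * q ^ 2 <= k / 2 / 4 * q ^ 2)
  by (apply Rmult_le_compat_r; [exact Hq | unfold lam; lra]).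
assert (lam * p ^ 2 <= mu * k / 2 / 4 * p ^ 2)
  by (apply Rmult_le_compat_r; [exact Hp | unfold lam; lra]).
lra.
Qed.

(** The integral gain is either small enough for the fixed multiplier or bounded
    away from [0]; the other two coefficients are bounded below by their values
    at the threshold. *)
Lemma dissipative_below (L1 L2 kap kad W : R) :
  0 < L1 -> 0 < L2 -> 0 < kap -> 0 < kad ->
  exists lam, 0 < lam /\
  forall w, omega_star L1 L2 kap kad < w <= W ->
    exists mu m, 0 <= m <= L2 /\
      dissipative L2 (damping L2 kad w) (stiffness L1 kap kad w) (w * kap) mu m lam.
Proof.
intros hL1 hL2 hkap hkad.
destruct (threshold_nondegenerate L1 L2 kap kad hL1 hL2 hkap hkad) as [Hw [Ha Hb]].
set (ws := omega_star L1 L2 kap kad) in *.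
set (a := damping L2 kad ws) in *; set (b := stiffness L1 kap kad ws) in *.
assert (Hmono : forall w, ws < w ->
   a <= damping L2 kad w /\ b <= stiffness L1 kap kad w).
{ intros w Hlt; unfold a, b, damping, stiffness; split; nra. }
destruct (dissipative_small_integral L2 (Rmin a b) hL2 ltac:(apply Rmin_glb_lt; assumption))
  as (c & lam0 & Hc & Hlam0 & Hsmall).
assert (Hab1 := Rmin_l a b); assert (Hab2 := Rmin_r a b).
set (k := Rmin (Rmin a b) c).
assert (Hk : 0 < k).
{ unfold k; apply Rmin_glb_lt; [apply Rmin_glb_lt|]; assumption. }
assert (Hk1 : k <= Rmin a b) by apply Rmin_l.
assert (Hk2 : k <= c) by apply Rmin_r.
set (K := k + Rabs (damping L2 kad W) + Rabs (stiffness L1 kap kad W) + Rabs (W * kap)).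
assert (A1 := Rabs_pos (damping L2 kad W)); assert (A2 := Rabs_pos (stiffness L1 kap kad W));
assert (A3 := Rabs_pos (W * kap)).
assert (B1 := Rle_abs (damping L2 kad W)); assert (B2 := Rle_abs (stiffness L1 kap kad W));
assert (B3 := Rle_abs (W * kap)).
destruct (dissipative_uniform L2 k K hL2 Hk ltac:(unfold K; lra))
  as (lam1 & Hlam1 & Hunif).
exists (Rmin lam0 lam1); split; [apply Rmin_glb_lt; assumption|].
intros w [Hw1 Hw2].
destruct (Hmono w Hw1) as [Ma Mb].
destruct (Rle_or_lt (w * kap) c) as [Hcase|Hcase].
- destruct (Hsmall (damping L2 kad w) (stiffness L1 kap kad w) (w * kap)
    ltac:(lra) ltac:(lra) Hcase) as [mu Hmu].
  exists mu, L2; split; [lra|].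
  apply (dissipative_weaken _ _ _ _ _ _ lam0); [apply Rmin_l | exact Hmu].
- destruct (stability_above_threshold L1 L2 kap kad hL2 hkap hkad w Hw1)
    as (_ & _ & HQ & HQ2).
  assert (D1 : damping L2 kad w <= damping L2 kad W) by (unfold damping; lra).
  assert (D2 : stiffness L1 kap kad w <= stiffness L1 kap kad W)
    by (unfold stiffness; nra).
  assert (D3 : w * kap <= W * kap) by nra.
  destruct (Hunif (damping L2 kad w) (stiffness L1 kap kad w) (w * kap))
    as (mu & m & Hm & Hdis).
  + unfold K; lra.
  + unfold K; lra.
  + unfold K; lra.
  + exact HQ.
  + left; exact HQ2.
  + exists mu, m; split; [exact Hm|].
    apply (dissipative_weaken _ _ _ _ _ _ lam1); [apply Rmin_r | exact Hdis].
Qed.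

(** * The Lyapunov function of the integral loop *)

(** Multiply [q' + phi p + (A + theta) q + y = 0] by [q + mu p], where [p' = q]
    and [y' = C p]: up to the last term, the energy collects the exact
    derivatives, with [A + m] in place of the time-varying damping. *)
Definition energy (A C mu m ep Phi p q y : R) : R :=
  q ^ 2 / 2 + Phi + y * p + mu * (p * q) + mu * (A + m) * p ^ 2 / 2
  + mu * y ^ 2 / (2 * C) + ep * (y * q).

Definition energy_rate (A C mu m ep phi p q y dq dy : R) : R :=
  q * dq + phi * q + dy * p + y * q + mu * (q ^ 2 + p * dq) + mu * (A + m) * (p * q)
  + mu * (y * dy) / C + ep * (dy * q + y * dq).

(** The coefficient of the cross term [y q], which provides dissipation in [y]:
    small enough not to spoil the definiteness of the energy nor to use up the
    margin [lam]. *)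
Definition coupling (K lam : R) : R := lam / (16 * K ^ 3).

Lemma young (c a b : R) : 0 < c -> a * b <= c / 2 * a ^ 2 + / (2 * c) * b ^ 2.
Proof.
intros Hc; apply (Rmult_le_reg_l (2 * c)); [lra|].
replace (2 * c * (c / 2 * a ^ 2 + / (2 * c) * b ^ 2)) with (c ^ 2 * a ^ 2 + b ^ 2)
  by (field; lra).
assert (H := pow2_ge_0 (c * a - b)); nra.
Qed.

Section Energy.

Variables L K lam A B C mu m : R.
Hypothesis HL : 0 < L.
Hypothesis HK : 1 <= K.
Hypothesis Hlam : 0 < lam <= 1.
Hypothesis HA : A + 2 * L <= K.
Hypothesis HB : 0 < B <= K.
Hypothesis HC : 0 < C <= K.
Hypothesis Hm : 0 <= m <= L.
Hypothesis Hdis : dissipative L A B C mu m lam.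

Let ep := coupling K lam.

Lemma multiplier_bounds :
  lam <= A - mu /\ lam <= mu * B - C /\ 0 < mu <= K /\ lam <= mu * K.
Proof.
assert (H1 := Hdis 0 0 1 ltac:(lra)); assert (H2 := Hdis 0 1 0 ltac:(lra)).
assert (lam <= A - mu) by lra.
assert (lam <= mu * B - C) by lra.
assert (Hmu : 0 < mu) by (apply Rnot_le_lt; intros H'; nra).
repeat split; try lra; nra.
Qed.

Lemma coupling_bounds : 0 < ep <= 1 / 16 /\ ep * (16 * K ^ 3) = lam /\ ep <= lam.
Proof.
assert (HK3 : 1 <= K ^ 3) by (apply pow_R1_Rle; exact HK).
assert (E : ep * (16 * K ^ 3) = lam) by (unfold ep, coupling; field; lra).
assert (H0 : 0 < ep) by (apply Rdiv_lt_0_compat; lra).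
repeat split; nra.
Qed.

Lemma energy_lower (Phi p q y : R) :
  B * p ^ 2 / 2 <= Phi ->
  ep / 2 * (p ^ 2 + q ^ 2 + y ^ 2) <= energy A C mu m ep Phi p q y.
Proof.
intros HPhi.
destruct multiplier_bounds as (M1 & M2 & M3 & M4).
destruct coupling_bounds as (E1 & E2 & E3).
assert (Hp := pow2_ge_0 p); assert (Hq := pow2_ge_0 q); assert (Hy := pow2_ge_0 y).
assert (HK2 : 1 <= K ^ 2) by (apply pow_R1_Rle; exact HK).
(* B p ^ 2 + 2 y p + mu y ^ 2 / C is bounded below by its minimum over y and by
   its minimum over p; the average of the two keeps both variables. *)
assert (F1 : (B - C / mu) * p ^ 2 <= B * p ^ 2 + 2 * (y * p) + mu * y ^ 2 / C).
{ replace (B * p ^ 2 + 2 * (y * p) + mu * y ^ 2 / C)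
    with ((B - C / mu) * p ^ 2 + (mu * y + C * p) ^ 2 / (mu * C)) by (field; lra).
  assert (0 <= (mu * y + C * p) ^ 2 / (mu * C)); [|lra].
  apply Rle_mult_inv_pos; [apply pow2_ge_0 | nra]. }
assert (F2 : (mu * B - C) / (B * C) * y ^ 2 <= B * p ^ 2 + 2 * (y * p) + mu * y ^ 2 / C).
{ replace (B * p ^ 2 + 2 * (y * p) + mu * y ^ 2 / C)
    with ((mu * B - C) / (B * C) * y ^ 2 + (B * p + y) ^ 2 / B) by (field; lra).
  assert (0 <= (B * p + y) ^ 2 / B); [|lra].
  apply Rle_mult_inv_pos; [apply pow2_ge_0 | lra]. }
assert (G1 : lam / K <= B - C / mu).
{ apply (Rmult_le_reg_r (K * mu)); [nra|].
  replace (lam / K * (K * mu)) with (lam * mu) by (field; lra).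
  replace ((B - C / mu) * (K * mu)) with (K * (mu * B - C)) by (field; lra).
  nra. }
assert (G2 : lam / K ^ 2 <= (mu * B - C) / (B * C)).
{ assert (0 < B * C) by nra.
  assert (B * C <= K ^ 2) by nra.
  apply Rle_trans with (lam / (B * C)).
  - apply Rmult_le_compat_l; [lra|]; apply Rinv_le_contravar; lra.
  - apply Rmult_le_compat_r; [left; apply Rinv_0_lt_compat; lra | lra]. }
assert (G1' : lam / K * p ^ 2 <= (B - C / mu) * p ^ 2) by (apply Rmult_le_compat_r; lra).
assert (G2' : lam / K ^ 2 * y ^ 2 <= (mu * B - C) / (B * C) * y ^ 2)
  by (apply Rmult_le_compat_r; lra).
assert (Ek1 : lam / K = ep * (16 * K ^ 2)) by (unfold ep, coupling; field; lra).
assert (Ek2 : lam / K ^ 2 = ep * (16 * K)) by (unfold ep, coupling; field; lra).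
rewrite Ek1 in G1'; rewrite Ek2 in G2'.
assert (F3 : (q + mu * p) ^ 2 <= q ^ 2 + 2 * (mu * (p * q)) + mu * (A + m) * p ^ 2).
{ assert (0 <= mu * (A + m - mu)) by nra; nra. }
assert (F4 : q ^ 2 <= 2 * (q + mu * p) ^ 2 + 2 * K ^ 2 * p ^ 2).
{ assert (H := pow2_ge_0 (q + 2 * (mu * p))).
  assert (mu ^ 2 * p ^ 2 <= K ^ 2 * p ^ 2); [|nra].
  apply Rmult_le_compat_r; [exact Hp | apply pow_incr; lra]. }
assert (F4' : ep * q ^ 2 <= ep * (2 * (q + mu * p) ^ 2 + 2 * K ^ 2 * p ^ 2))
  by (apply Rmult_le_compat_l; lra).
assert (F5 : 0 <= (q + mu * p) ^ 2) by apply pow2_ge_0.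
assert (F5' : 2 * ep * (q + mu * p) ^ 2 <= / 8 * (q + mu * p) ^ 2)
  by (apply Rmult_le_compat_r; lra).
assert (F6 : - (y ^ 2 + q ^ 2) / 2 <= y * q) by (assert (H := pow2_ge_0 (y + q)); nra).
assert (F6' : ep * (- (y ^ 2 + q ^ 2) / 2) <= ep * (y * q))
  by (apply Rmult_le_compat_l; lra).
assert (F7 : ep * p ^ 2 <= ep * K ^ 2 * p ^ 2) by (apply Rmult_le_compat_r; nra).
assert (F8 : ep * y ^ 2 <= ep * K * y ^ 2) by (apply Rmult_le_compat_r; nra).
assert (F9 : mu * y ^ 2 / (2 * C) = mu * y ^ 2 / C / 2) by (field; lra).
assert (0 <= ep * p ^ 2) by (apply Rmult_le_pos; lra).
assert (0 <= ep * y ^ 2) by (apply Rmult_le_pos; lra).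
unfold energy; rewrite F9; lra.
Qed.

Lemma energy_upper (Phi p q y : R) :
  Phi <= K * p ^ 2 / 2 ->
  C * energy A C mu m ep Phi p q y
    <= 4 * K ^ 2 * (C * p ^ 2 + C * q ^ 2 + y ^ 2).
Proof.
intros HPhi.
destruct multiplier_bounds as (M1 & M2 & M3 & M4).
destruct coupling_bounds as (E1 & E2 & E3).
assert (Hp := pow2_ge_0 p); assert (Hq := pow2_ge_0 q); assert (Hy := pow2_ge_0 y).
assert (HK2 : K <= K ^ 2) by nra.
assert (F1 : C * (y * p) <= (C * y ^ 2 + C * p ^ 2) / 2)
  by (assert (H := pow2_ge_0 (y - p)); nra).
assert (F2 : C * (mu * (p * q)) <= K * ((C * p ^ 2 + C * q ^ 2) / 2)).
{ assert (p * q <= (p ^ 2 + q ^ 2) / 2) by (assert (H := pow2_ge_0 (p - q)); nra).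
  assert (mu * (p * q) <= K * ((p ^ 2 + q ^ 2) / 2)).
  { apply Rle_trans with (mu * ((p ^ 2 + q ^ 2) / 2)).
    - apply Rmult_le_compat_l; lra.
    - apply Rmult_le_compat_r; lra. }
  assert (C * (mu * (p * q)) <= C * (K * ((p ^ 2 + q ^ 2) / 2)))
    by (apply Rmult_le_compat_l; lra).
  lra. }
assert (F3 : C * (mu * (A + m) * p ^ 2 / 2) <= K ^ 2 * (C * p ^ 2)).
{ assert (mu * (A + m) <= K * K) by (apply Rmult_le_compat; lra).
  assert (0 <= C * p ^ 2) by nra.
  assert (mu * (A + m) * (C * p ^ 2) <= K * K * (C * p ^ 2))
    by (apply Rmult_le_compat_r; assumption).
  nra. }
assert (F4 : C * (mu * y ^ 2 / (2 * C)) <= K * y ^ 2 / 2).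
{ replace (C * (mu * y ^ 2 / (2 * C))) with (mu * y ^ 2 / 2) by (field; lra).
  assert (mu * y ^ 2 <= K * y ^ 2) by (apply Rmult_le_compat_r; lra); lra. }
assert (F5 : C * (ep * (y * q)) <= (C * y ^ 2 + C * q ^ 2) / 2).
{ assert (ep * (y * q) <= (y ^ 2 + q ^ 2) / 2).
  { apply Rle_trans with (ep * ((y ^ 2 + q ^ 2) / 2)).
    - apply Rmult_le_compat_l; [lra|]; assert (H := pow2_ge_0 (y - q)); nra.
    - nra. }
  nra. }
assert (F6 : C * y ^ 2 <= K * y ^ 2) by (apply Rmult_le_compat_r; lra).
assert (F7 : C * Phi <= K * (C * p ^ 2) / 2) by nra.
assert (F8 : forall z, 0 <= z -> K * z <= K ^ 2 * z /\ z <= K ^ 2 * z /\ 0 <= z).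
{ intros z Hz; repeat split; nra. }
destruct (F8 (C * p ^ 2) ltac:(nra)) as (? & ? & ?);
destruct (F8 (C * q ^ 2) ltac:(nra)) as (? & ? & ?);
destruct (F8 (y ^ 2) ltac:(nra)) as (? & ? & ?).
unfold energy; lra.
Qed.

Lemma energy_decay (theta phi p q y g rho : R) :
  0 <= theta <= 2 * L -> B * p ^ 2 <= phi * p -> phi ^ 2 <= K ^ 2 * p ^ 2 ->
  energy_rate A C mu m ep phi p q y
    (- y - phi - (A + theta) * q + g) (C * (p + rho))
  <= - (ep / 2) * (p ^ 2 + q ^ 2 + y ^ 2) + 8 * K ^ 2 / ep * (g ^ 2 + rho ^ 2).
Proof.
intros Hth Hphi Hphi2.
destruct multiplier_bounds as (M1 & M2 & M3 & M4).
destruct coupling_bounds as (E1 & E2 & E3).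
assert (Hp := pow2_ge_0 p); assert (Hq := pow2_ge_0 q); assert (Hy := pow2_ge_0 y).
assert (Hg := pow2_ge_0 g); assert (Hr := pow2_ge_0 rho).
assert (HK2 : 1 <= K ^ 2) by (apply pow_R1_Rle; exact HK).
assert (Hform := Hdis theta p q Hth).
assert (Hsec : mu * (B * p ^ 2) <= mu * (phi * p)) by (apply Rmult_le_compat_l; lra).
assert (Eq : energy_rate A C mu m ep phi p q y
    (- y - phi - (A + theta) * q + g) (C * (p + rho))
  = - ((A + theta - mu) * q ^ 2 + (mu * (phi * p) - C * p ^ 2)
       + mu * (theta - m) * (p * q))
    - ep * y ^ 2
    + (ep * (- y * phi) + ep * (- y * ((A + theta) * q)) + ep * (C * (p * q)))
    + (g * q + mu * (g * p) + C * (rho * p) + mu * (rho * y)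
       + ep * (C * (rho * q)) + ep * (y * g)))
  by (unfold energy_rate; field; lra).
rewrite Eq; clear Eq.
assert (Hlam_ep : 16 * (ep * K ^ 2) <= lam).
{ rewrite <- E2; assert (ep * K ^ 2 * 1 <= ep * K ^ 2 * K); [|nra].
  apply Rmult_le_compat_l; nra. }
assert (C1 : - y * phi <= y ^ 2 / 8 + 2 * (K ^ 2 * p ^ 2))
  by (assert (H := pow2_ge_0 (y / 2 + 2 * phi)); nra).
assert (C2 : - y * ((A + theta) * q) <= y ^ 2 / 8 + 2 * (K ^ 2 * q ^ 2)).
{ assert (((A + theta) * q) ^ 2 <= K ^ 2 * q ^ 2).
  { replace (((A + theta) * q) ^ 2) with ((A + theta) ^ 2 * q ^ 2) by ring.
    apply Rmult_le_compat_r; [exact Hq | apply pow_incr; lra]. }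
  assert (Hs := pow2_ge_0 (y / 2 + 2 * ((A + theta) * q))); nra. }
assert (C3 : C * (p * q) <= K ^ 2 * ((p ^ 2 + q ^ 2) / 2)).
{ apply Rle_trans with (C * ((p ^ 2 + q ^ 2) / 2)).
  - apply Rmult_le_compat_l; [lra|]; assert (H := pow2_ge_0 (p - q)); nra.
  - apply Rmult_le_compat_r; [lra | nra]. }
assert (C1' := Rmult_le_compat_l ep _ _ ltac:(lra) C1).
assert (C2' := Rmult_le_compat_l ep _ _ ltac:(lra) C2).
assert (C3' := Rmult_le_compat_l ep _ _ ltac:(lra) C3).
assert (Cp : 16 * (ep * K ^ 2) * p ^ 2 <= lam * p ^ 2) by (apply Rmult_le_compat_r; lra).
assert (Cq : 16 * (ep * K ^ 2) * q ^ 2 <= lam * q ^ 2) by (apply Rmult_le_compat_r; lra).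
(* part of the dissipation absorbs the forcing, by Young's inequality *)
assert (Hil : / lam <= / ep) by (apply Rinv_le_contravar; lra).
assert (Hie : 16 <= / ep).
{ apply (Rmult_le_reg_l ep); [lra|]; rewrite Rinv_r by lra; lra. }
assert (Y1 : forall k z x, 0 <= k <= K ->
          k * (z * x) <= lam / 8 * x ^ 2 + 2 * K ^ 2 / ep * z ^ 2).
{ intros k z x Hk.
  assert (H := young (lam / 4) x (k * z) ltac:(lra)).
  replace (/ (2 * (lam / 4)) * (k * z) ^ 2) with (2 * / lam * (k ^ 2 * z ^ 2)) in H
    by (field; lra).
  assert (Hz := pow2_ge_0 z).
  assert (k ^ 2 * z ^ 2 <= K ^ 2 * z ^ 2)
    by (apply Rmult_le_compat_r; [exact Hz | apply pow_incr; lra]).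
  assert (2 * / lam * (k ^ 2 * z ^ 2) <= 2 * / ep * (K ^ 2 * z ^ 2)).
  { apply Rmult_le_compat; try lra.
    - assert (0 < / lam) by (apply Rinv_0_lt_compat; lra); lra.
    - apply Rmult_le_pos; [apply pow2_ge_0 | exact Hz]. }
  replace (2 * K ^ 2 / ep * z ^ 2) with (2 * / ep * (K ^ 2 * z ^ 2)) by (field; lra).
  lra. }
assert (Y2 : forall k z, 0 <= k <= K ->
          k * (z * y) <= ep / 8 * y ^ 2 + 2 * K ^ 2 / ep * z ^ 2).
{ intros k z Hk.
  assert (H := young (ep / 4) y (k * z) ltac:(lra)).
  replace (/ (2 * (ep / 4)) * (k * z) ^ 2) with (2 / ep * (k ^ 2 * z ^ 2)) in H
    by (field; lra).
  assert (Hz := pow2_ge_0 z).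
  assert (k ^ 2 * z ^ 2 <= K ^ 2 * z ^ 2)
    by (apply Rmult_le_compat_r; [exact Hz | apply pow_incr; lra]).
  assert (2 / ep * (k ^ 2 * z ^ 2) <= 2 / ep * (K ^ 2 * z ^ 2)).
  { apply Rmult_le_compat_l; [unfold Rdiv; lra | assumption]. }
  replace (2 * K ^ 2 / ep * z ^ 2) with (2 / ep * (K ^ 2 * z ^ 2)) by (field; lra).
  lra. }
assert (T1 := Y1 1 g q ltac:(lra)).
assert (T2 := Y1 mu g p ltac:(lra)).
assert (T3 := Y1 C rho p ltac:(lra)).
assert (T4 := Y2 mu rho ltac:(lra)).
assert (T5 := Y1 (ep * C) rho q ltac:(nra)).
assert (T6 := Y2 ep g ltac:(lra)).
set (z := 2 * K ^ 2 / ep) in *.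
replace (8 * K ^ 2 / ep) with (4 * z) by (unfold z; field; lra).
assert (Hz : 0 <= z) by (apply Rle_mult_inv_pos; lra).
assert (0 <= z * g ^ 2) by (apply Rmult_le_pos; assumption).
assert (0 <= z * rho ^ 2) by (apply Rmult_le_pos; assumption).
assert (ep * p ^ 2 <= lam * p ^ 2) by (apply Rmult_le_compat_r; lra).
assert (ep * q ^ 2 <= lam * q ^ 2) by (apply Rmult_le_compat_r; lra).
nra.
Qed.

End Energy.

Lemma primitive_sector (phi Phi : R -> R) (a x : R) :
  Phi 0 = 0 -> (forall z, is_derive Phi z (phi z)) ->
  (forall z, a * z ^ 2 <= phi z * z) -> a * x ^ 2 / 2 <= Phi x.
Proof.
intros H0 HPhi Hsec.
set (f := fun z => Phi z - a * z ^ 2 / 2).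
assert (Hf : forall z, is_derive f z (phi z - a * z)).
{ intros z; assert (H := HPhi z); unfold f; derive_by_hyps; field. }
assert (Hf0 : f 0 = 0) by (unfold f; rewrite H0; field).
assert (Hsgn : forall z, 0 <= (phi z - a * z) * z) by (intros z; specialize (Hsec z); lra).
assert (0 <= f x); [|unfold f in *; lra].
destruct (Rtotal_order x 0) as [Hx|[->|Hx]]; [|lra|].
- destruct (MVT_cor2 f (fun z => phi z - a * z) x 0 Hx) as [c [Heq Hc]].
  + intros z _; apply is_derive_Reals, Hf.
  + specialize (Hsgn c); nra.
- destruct (MVT_cor2 f (fun z => phi z - a * z) 0 x Hx) as [c [Heq Hc]].
  + intros z _; apply is_derive_Reals, Hf.
  + specialize (Hsgn c); nra.
Qed.

Section Lure.

Variables L K lam A B C mu m : R.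
Hypothesis HL : 0 < L.
Hypothesis HK : 1 <= K.
Hypothesis Hlam : 0 < lam <= 1.
Hypothesis HA : A + 2 * L <= K.
Hypothesis HB : 0 < B <= K.
Hypothesis HC : 0 < C <= K.
Hypothesis Hm : 0 <= m <= L.
Hypothesis Hdis : dissipative L A B C mu m lam.

Variables phi Phi p q y dq g rho : R -> R.
Hypothesis HPhi0 : Phi 0 = 0.
Hypothesis HPhi : forall x, is_derive Phi x (phi x).
Hypothesis Hsec : forall x, B * x ^ 2 <= phi x * x.
Hypothesis Hgrowth : forall x, Rabs (phi x) <= K * Rabs x.
Hypothesis Sp : smooth p q.
Hypothesis Sq : smooth q dq.
Hypothesis Sy : smooth y (fun t => C * (p t + rho t)).
Hypothesis Hdq : forall t, 0 <= t -> exists theta, 0 <= theta <= 2 * L /\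
  dq t = - y t - phi (p t) - (A + theta) * q t + g t.

Let ep := coupling K lam.
Let W t := energy A C mu m ep (Phi (p t)) (p t) (q t) (y t).
Let dW t := energy_rate A C mu m ep (phi (p t)) (p t) (q t) (y t) (dq t)
              (C * (p t + rho t)).
Let rate := ep * C / (8 * K ^ 3).

Lemma energy_smooth : smooth W dW.
Proof.
intros t Ht; assert (H1 := Sp t Ht); assert (H2 := Sq t Ht);
assert (H3 := Sy t Ht); assert (H4 := HPhi (p t)); simpl in H3.
unfold W, dW, energy, energy_rate.
derive_by_hyps; field; lra.
Qed.

Lemma rate_pos : 0 < ep /\ 0 < rate.
Proof.
destruct (coupling_bounds K lam HK Hlam) as [[H1 _] _]; fold ep in H1.
split; [exact H1|].
apply Rdiv_lt_0_compat; [apply Rmult_lt_0_compat; lra|].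
assert (H := pow_lt K 3 ltac:(lra)); lra.
Qed.

Lemma energy_bounds (t : R) :
  ep / 2 * (p t ^ 2 + q t ^ 2 + y t ^ 2) <= W t /\
  C * W t <= 4 * K ^ 3 * (p t ^ 2 + q t ^ 2 + y t ^ 2).
Proof.
split.
- apply (energy_lower L K lam A B C mu m); try assumption.
  apply (primitive_sector phi); assumption.
- eapply Rle_trans.
  + apply (energy_upper L K lam A B C mu m); try assumption.
    assert (H := primitive_sector (fun x => - phi x) (fun x => - Phi x) (- K) (p t)).
    assert (- K * p t ^ 2 / 2 <= - Phi (p t)); [|lra].
    apply H.
    * rewrite HPhi0; ring.
    * intros z; assert (H4 := HPhi z); derive_by_hyps; ring.
    * intros z; specialize (Hgrowth z).
      assert (Hz : phi z * z <= K * z ^ 2); [|lra].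
      rewrite <- pow2_abs; eapply Rle_trans; [apply Rle_abs|].
      rewrite Rabs_mult; assert (Hz := Rabs_pos z); nra.
  + assert (Hp := pow2_ge_0 (p t)); assert (Hq := pow2_ge_0 (q t));
    assert (Hy := pow2_ge_0 (y t)).
    replace (4 * K ^ 3 * (p t ^ 2 + q t ^ 2 + y t ^ 2))
      with (4 * K ^ 2 * (K * p t ^ 2 + K * q t ^ 2 + K * y t ^ 2)) by ring.
    apply Rmult_le_compat_l; nra.
Qed.

Lemma energy_inequality (t : R) :
  0 <= t -> dW t <= - rate * W t + 8 * K ^ 2 / ep * (g t ^ 2 + rho t ^ 2).
Proof.
intros Ht; destruct (Hdq t Ht) as [theta [Hth Heq]].
unfold dW; rewrite Heq.
eapply Rle_trans.
- apply (energy_decay L K lam A B C mu m); try assumption.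
  + apply Hsec.
  + rewrite <- (pow2_abs (phi (p t))), <- (pow2_abs (p t)).
    replace (K ^ 2 * Rabs (p t) ^ 2) with ((K * Rabs (p t)) ^ 2) by ring.
    apply pow_incr; split; [apply Rabs_pos | apply Hgrowth].
- fold ep; apply Rplus_le_compat_r.
  destruct (energy_bounds t) as [_ HW]; destruct rate_pos as [He _].
  assert (HK3 := pow_lt K 3 ltac:(lra)).
  assert (rate * W t <= ep / 2 * (p t ^ 2 + q t ^ 2 + y t ^ 2)); [|lra].
  replace (rate * W t) with (ep / (8 * K ^ 3) * (C * W t))
    by (unfold rate; field; lra).
  replace (ep / 2 * (p t ^ 2 + q t ^ 2 + y t ^ 2))
    with (ep / (8 * K ^ 3) * (4 * K ^ 3 * (p t ^ 2 + q t ^ 2 + y t ^ 2)))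
    by (field; lra).
  apply Rmult_le_compat_l; [|exact HW].
  apply Rle_mult_inv_pos; lra.
Qed.

(** The energy starts at the order of [y ^ 2 / C] and decays at a rate
    proportional to [C], whence the factor [C] on the left. *)
Lemma lure_bounded (G t : R) :
  (forall s, 0 <= s -> g s ^ 2 <= G /\ rho s ^ 2 <= G) -> 0 <= t ->
  C * (p t ^ 2 + q t ^ 2 + y t ^ 2)
  <= 8 * K ^ 3 / ep * (p 0 ^ 2 + q 0 ^ 2 + y 0 ^ 2) + 256 * K ^ 5 / ep ^ 3 * G.
Proof.
intros HG Ht; destruct rate_pos as [He Hr].
assert (HG0 : 0 <= G).
{ destruct (HG 0 (Rle_refl 0)) as [H _]; assert (Hp := pow2_ge_0 (g 0)); lra. }
assert (HK2 := pow_lt K 2 ltac:(lra)).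
assert (HK3 := pow_lt K 3 ltac:(lra)).
assert (Hk : 0 < 8 * K ^ 2 / ep) by (apply Rdiv_lt_0_compat; lra).
destruct (energy_bounds t) as [Lt _]; destruct (energy_bounds 0) as [L0 U0].
assert (HW : W t <= W 0 + 8 * K ^ 2 / ep * (2 * G) / rate).
{ apply (comparison_bound W dW rate); try assumption.
  - apply Rmult_le_pos; lra.
  - eapply Rle_trans; [|exact L0]; apply Rmult_le_pos; [lra|].
    assert (Hp := pow2_ge_0 (p 0)); assert (Hq := pow2_ge_0 (q 0));
    assert (Hy := pow2_ge_0 (y 0)); lra.
  - exact energy_smooth.
  - intros s Hs; eapply Rle_trans; [apply energy_inequality; exact Hs|].
    apply Rplus_le_compat_l, Rmult_le_compat_l; [lra|].
    destruct (HG s Hs); lra. }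
apply (Rmult_le_reg_l (ep / 2)); [lra|].
replace (ep / 2 * (C * (p t ^ 2 + q t ^ 2 + y t ^ 2)))
  with (C * (ep / 2 * (p t ^ 2 + q t ^ 2 + y t ^ 2))) by ring.
apply Rle_trans with (C * (W 0 + 8 * K ^ 2 / ep * (2 * G) / rate)).
- apply Rmult_le_compat_l; lra.
- replace (C * (W 0 + 8 * K ^ 2 / ep * (2 * G) / rate))
    with (C * W 0 + ep / 2 * (256 * K ^ 5 / ep ^ 3 * G))
    by (unfold rate; field; lra).
  replace (ep / 2 * (8 * K ^ 3 / ep * (p 0 ^ 2 + q 0 ^ 2 + y 0 ^ 2)
             + 256 * K ^ 5 / ep ^ 3 * G))
    with (4 * K ^ 3 * (p 0 ^ 2 + q 0 ^ 2 + y 0 ^ 2)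
          + ep / 2 * (256 * K ^ 5 / ep ^ 3 * G)) by (field; lra).
  lra.
Qed.

Lemma lure_converges :
  is_lim g p_infty 0 -> is_lim rho p_infty 0 ->
  is_lim p p_infty 0 /\ is_lim q p_infty 0.
Proof.
intros Hg Hrho; destruct rate_pos as [He Hr].
assert (LW : is_lim W p_infty 0).
{ apply (comparison_to_zero W dW
           (fun t => 8 * K ^ 2 / ep * (g t ^ 2 + rho t ^ 2)) rate); try assumption.
  - exact energy_smooth.
  - intros t _; destruct (energy_bounds t) as [Lt _].
    eapply Rle_trans; [|exact Lt]; apply Rmult_le_pos; [lra|].
    assert (Hp := pow2_ge_0 (p t)); assert (Hq := pow2_ge_0 (q t));
    assert (Hy := pow2_ge_0 (y t)); lra.
  - exact energy_inequality.
  - apply (is_lim_infty_ext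
      (fun t => 8 * K ^ 2 / ep * g t ^ 2 + 8 * K ^ 2 / ep * rho t ^ 2)).
    + intros t _; ring.
    + replace (Finite 0) with (Finite (8 * K ^ 2 / ep * 0 + 8 * K ^ 2 / ep * 0))
        by (f_equal; ring).
      apply is_lim_infty_comb; apply is_lim_infty_sq; assumption. }
split.
- apply (is_lim_infty_sq_le p W 0 (ep / 2)); [lra | | exact LW].
  intros t _; destruct (energy_bounds t) as [Lt _].
  assert (Hq := pow2_ge_0 (q t)); assert (Hy := pow2_ge_0 (y t)); nra.
- apply (is_lim_infty_sq_le q W 0 (ep / 2)); [lra | | exact LW].
  intros t _; destruct (energy_bounds t) as [Lt _].
  assert (Hp := pow2_ge_0 (p t)); assert (Hy := pow2_ge_0 (y t)); nra.
Qed.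

End Lure.

(** * The closed loop with integral action *)

Definition has_partials (L1 L2 : R) (h h1 h2 : R -> R -> R) : Prop :=
  forall x1 x2,
    is_derive (fun x => h x x2) x1 (h1 x1 x2) /\
    is_derive (fun x => h x1 x) x2 (h2 x1 x2) /\
    Rabs (h1 x1 x2) <= L1 /\ Rabs (h2 x1 x2) <= L2.

Lemma mean_slope (f df : R -> R) (L a b : R) :
  (forall x, is_derive f x (df x)) -> (forall x, Rabs (df x) <= L) ->
  exists s, Rabs s <= L /\ f b - f a = s * (b - a).
Proof.
intros Hf Hdf.
destruct (MVT_gen f a b df) as [c [_ Hc]].
- intros x _; apply Hf.
- intros x _; apply (is_derive_continuity_pt f x (df x)), Hf.
- exists (df c); split; [apply Hdf | exact Hc].
Qed.

Lemma partials_increment (L1 L2 : R) (h h1 h2 : R -> R -> R) (a a' b b' : R) :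
  has_partials L1 L2 h h1 h2 ->
  Rabs (h a' b' - h a b) <= L1 * Rabs (a' - a) + L2 * Rabs (b' - b).
Proof.
intros H.
destruct (mean_slope (fun x => h x b') (fun x => h1 x b') L1 a a')
  as [s1 [B1 E1]]; try (intros x; apply (H x b')).
destruct (mean_slope (fun x => h a x) (fun x => h2 a x) L2 b b')
  as [s2 [B2 E2]]; try (intros x; apply (H a x)).
replace (h a' b' - h a b) with (s1 * (a' - a) + s2 * (b' - b)) by lra.
eapply Rle_trans; [apply Rabs_triang|]; rewrite !Rabs_mult.
apply Rplus_le_compat; apply Rmult_le_compat_r;
  (apply Rabs_pos || assumption).
Qed.

Lemma partials_chain_rule (L1 L2 : R) (h h1 h2 : R -> R -> R) (x y : R -> R)
    (t dx dy : R) :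
  has_partials L1 L2 h h1 h2 ->
  (forall u : R * R, continuous (fun v : R * R => h1 (fst v) (snd v)) u) ->
  is_derive x t dx -> is_derive y t dy ->
  is_derive (fun s => h (x s) (y s)) t (h1 (x t) (y t) * dx + h2 (x t) (y t) * dy).
Proof.
intros H Hc Hx Hy.
assert (Hd := is_derive_filterdiff h (x t) (y t) h1 (h2 (x t) (y t))).
assert (Hd' := Hd (filter_forall _ (fun u => proj1 (H (fst u) (snd u))))
                  (proj1 (proj2 (H (x t) (y t)))) (Hc _)); clear Hd.
assert (Hcomp := filterdiff_comp'_2 x y h t _ _
  (fun u v : R => plus (scal u (h1 (x t) (y t))) (scal v (h2 (x t) (y t)))) Hx Hy Hd').
unfold is_derive.
eapply filterdiff_ext_lin; [exact Hcomp|].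
intros z; unfold plus, scal; simpl; unfold mult; simpl; ring.
Qed.

Lemma limit_bounded (w : R -> R) (l L : R) :
  (forall t, 0 <= t -> Rabs (w t) <= L) -> is_lim w p_infty l ->
  forall t, 0 <= t -> Rabs (w t - l) <= 2 * L.
Proof.
intros Hw Hl t Ht.
assert (Hb : Rabs l <= L).
{ apply le_epsilon; intros eps Heps.
  destruct (proj1 (is_lim_infty_eps w l) Hl eps Heps) as [T [HT0 HT]].
  specialize (HT T (Rle_refl T)); specialize (Hw T HT0).
  apply Rabs_le_between in HT; apply Rabs_le_between in Hw.
  apply Rabs_le_between; lra. }
specialize (Hw t Ht).
apply Rabs_le_between in Hb; apply Rabs_le_between in Hw.
apply Rabs_le_between; lra.
Qed.

Definition acceleration (kap kad om : R) (h : R -> R -> R)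
    (w r dr ddr x1 x2 Y : R -> R) (t : R) : R :=
  h (x1 t) (x2 t) + w t + (kap + om * kad) * (r t - x1 t)
  + (kad + om) * (dr t - x2 t) + Y t + ddr t.

(** The PID loop with the integral term [Y] as a state.  With
    [Y = - fhat - om (kad e + e')] it is also the observer-based loop. *)
Definition integral_loop (kap kad om : R) (h : R -> R -> R)
    (w r dr ddr x1 x2 Y : R -> R) : Prop :=
  smooth x1 x2 /\
  smooth x2 (acceleration kap kad om h w r dr ddr x1 x2 Y) /\
  smooth Y (fun t => om * kap * (r t - x1 t)) /\
  x1 0 = r 0 /\ x2 0 = dr 0 /\ Y 0 = 0.

Definition estimation_error (kad om : R) (h : R -> R -> R)
    (w r dr x1 x2 Y : R -> R) (t : R) : R :=
  - (h (x1 t) (x2 t) + w t) - om * (kad * (r t - x1 t) + (dr t - x2 t)) - Y t.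

Lemma error_equation (kap kad om : R) (h : R -> R -> R)
    (w r dr ddr x1 x2 Y : R -> R) (t : R) :
  (ddr t - acceleration kap kad om h w r dr ddr x1 x2 Y t)
  + kad * (dr t - x2 t) + kap * (r t - x1 t)
  = estimation_error kad om h w r dr x1 x2 Y t.
Proof. unfold acceleration, estimation_error; ring. Qed.

(** * Bandwidths in a bounded range *)

(** The error is measured from the constant setpoint [yss] and not from [r]: the
    nonlinearity [phi] then does not depend on time, and the motion of the
    reference becomes the forcing [rho], [g]. *)
Section LureForm.

Variables L1 L2 kap kad W lam om mu m : R.
Hypothesis hL1 : 0 < L1.
Hypothesis hL2 : 0 < L2.
Hypothesis hkap : 0 < kap.
Hypothesis hkad : 0 < kad.
Hypothesis Hom : omega_star L1 L2 kap kad < om <= W.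
Hypothesis Hlam : 0 < lam <= 1.
Hypothesis Hm : 0 <= m <= L2.
Hypothesis Hdis : dissipative L2 (damping L2 kad om) (stiffness L1 kap kad om)
                    (om * kap) mu m lam.

Variables h h1 h2 : R -> R -> R.
Hypothesis Hh : has_partials L1 L2 h h1 h2.

Variables (w r dr ddr x1 x2 Y : R -> R) (winf yss : R).
Hypothesis Hloop : integral_loop kap kad om h w r dr ddr x1 x2 Y.

Let K := 1 + L1 + L2 + kap + kad + W + W * kad + W * kap.
Let phi x := (kap + om * kad) * x + (h (yss - x) 0 - h yss 0).
Let Phi x := (kap + om * kad) * x ^ 2 / 2
             + RInt (fun s => h (yss - s) 0 - h yss 0) 0 x.
Let p t := yss - x1 t.
Let q t := - x2 t.
Let y t := Y t + (h yss 0 + winf).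
Let rho t := r t - yss.
Let g t := - (w t - winf) - (kap + om * kad) * rho t - (kad + om) * dr t - ddr t.

Lemma lure_constants :
  1 <= K /\ damping L2 kad om + 2 * L2 <= K /\ 0 < stiffness L1 kap kad om <= K /\
  0 < om * kap <= K /\ kap + om * kad + L1 <= K /\ 0 < om.
Proof.
destruct (omega_star_lower_bounds L1 L2 kap kad hkad) as [H0 _].
destruct (stability_above_threshold L1 L2 kap kad hL2 hkap hkad om (proj1 Hom))
  as (HA & HB & _ & _).
assert (0 < om * kap <= W * kap) by nra.
assert (0 < om * kad <= W * kad) by nra.
unfold K, damping, stiffness in *; repeat split; lra.
Qed.

Lemma lure_primitive :
  Phi 0 = 0 /\ forall x, is_derive Phi x (phi x).
Proof.
assert (Hcont : forall s, continuous (fun s => h (yss - s) 0 - h yss 0) s).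
{ intros s; apply (ex_derive_continuous (K := R_AbsRing) (V := R_NormedModule)).
  destruct (Hh (yss - s) 0) as [Hd _].
  auto_derive; eexists; exact Hd. }
split.
- unfold Phi; rewrite RInt_point; unfold zero; simpl; field.
- intros x.
  assert (Hi : is_derive (fun x => RInt (fun s => h (yss - s) 0 - h yss 0) 0 x) x
                 (h (yss - x) 0 - h yss 0)).
  { apply (is_derive_RInt (fun s => h (yss - s) 0 - h yss 0) _ 0); [|apply Hcont].
    apply filter_forall; intros b.
    apply (RInt_correct (V := R_CompleteNormedModule)).
    apply (ex_RInt_continuous (V := R_CompleteNormedModule)).
    intros z _; apply Hcont. }
  apply (is_derive_plus (fun x => (kap + om * kad) * x ^ 2 / 2) _ x
          ((kap + om * kad) * x)); [|exact Hi].
  auto_derive; [exact I | field].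
Qed.

Lemma lure_nonlinearity (x : R) :
  stiffness L1 kap kad om * x ^ 2 <= phi x * x /\ Rabs (phi x) <= K * Rabs x.
Proof.
destruct lure_constants as (K1 & K2 & K3 & K4 & K5 & K6).
assert (H := partials_increment L1 L2 h h1 h2 yss (yss - x) 0 0 Hh).
rewrite Rminus_diag, Rabs_R0, Rmult_0_r, Rplus_0_r in H.
replace (yss - x - yss) with (- x) in H by ring; rewrite Rabs_Ropp in H.
assert (Hx := Rabs_pos x).
assert (0 < om * kad) by nra.
split.
- unfold phi, stiffness.
  assert (Hs : - (h (yss - x) 0 - h yss 0) * x <= L1 * x ^ 2); [|nra].
  eapply Rle_trans; [apply Rle_abs|]; rewrite Rabs_mult, Rabs_Ropp, <- pow2_abs.
  nra.
- unfold phi; eapply Rle_trans; [apply Rabs_triang|].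
  rewrite Rabs_mult, (Rabs_pos_eq (kap + om * kad)) by lra.
  nra.
Qed.

Lemma lure_dynamics :
  smooth p q /\
  smooth q (fun t => - acceleration kap kad om h w r dr ddr x1 x2 Y t) /\
  smooth y (fun t => om * kap * (p t + rho t)) /\
  (forall t, 0 <= t -> exists theta, 0 <= theta <= 2 * L2 /\
     - acceleration kap kad om h w r dr ddr x1 x2 Y t
     = - y t - phi (p t) - (damping L2 kad om + theta) * q t + g t).
Proof.
destruct Hloop as (S1 & S2 & S3 & _ & _ & _).
split; [|split; [|split]].
- intros t Ht; assert (H := S1 t Ht); unfold p, q; derive_by_hyps; ring.
- intros t Ht; assert (H := S2 t Ht); unfold q; derive_by_hyps; ring.
- intros t Ht; assert (H := S3 t Ht); simpl in H; unfold y, p, rho.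
  derive_by_hyps; ring.
- intros t Ht.
  destruct (mean_slope (fun x => h (x1 t) x) (fun x => h2 (x1 t) x) L2 0 (x2 t))
    as [s [Hs Es]]; try (intros x; apply (Hh (x1 t) x)).
  rewrite Rminus_0_r in Es.
  exists (L2 - s); split; [apply Rabs_le_between in Hs; lra|].
  unfold acceleration, y, phi, p, q, g, rho, damping.
  replace (yss - (yss - x1 t)) with (x1 t) by ring.
  replace (h (x1 t) (x2 t)) with (h (x1 t) 0 + s * x2 t) by lra.
  ring.
Qed.

Lemma loop_state_bounded (G t : R) :
  (forall s, 0 <= s -> g s ^ 2 <= G /\ rho s ^ 2 <= G) -> 0 <= t ->
  om * kap * (p t ^ 2 + q t ^ 2 + y t ^ 2)
  <= 8 * K ^ 3 / coupling K lam * (p 0 ^ 2 + q 0 ^ 2 + y 0 ^ 2)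
     + 256 * K ^ 5 / coupling K lam ^ 3 * G.
Proof.
intros HG Ht.
destruct lure_constants as (K1 & K2 & K3 & K4 & K5 & K6).
destruct lure_primitive as [P0 P1].
destruct lure_dynamics as (D1 & D2 & D3 & D4).
apply (lure_bounded L2 K lam (damping L2 kad om) (stiffness L1 kap kad om)
         (om * kap) mu m) with (phi := phi) (Phi := Phi) (g := g) (rho := rho)
         (dq := fun t => - acceleration kap kad om h w r dr ddr x1 x2 Y t);
  try assumption; intros x; apply lure_nonlinearity.
Qed.

Lemma loop_state_converges :
  is_lim w p_infty winf -> is_lim r p_infty yss -> is_lim dr p_infty 0 ->
  is_lim ddr p_infty 0 ->
  is_lim x1 p_infty yss /\ is_lim x2 p_infty 0.
Proof.
intros Lw Lr Ldr Lddr.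
destruct lure_constants as (K1 & K2 & K3 & K4 & K5 & K6).
destruct lure_primitive as [P0 P1].
destruct lure_dynamics as (D1 & D2 & D3 & D4).
assert (Lrho : is_lim rho p_infty 0).
{ replace (Finite 0) with (Finite (yss - yss)) by (f_equal; ring).
  apply is_lim_minus'; [exact Lr | apply is_lim_const]. }
assert (Lg : is_lim g p_infty 0).
{ apply (is_lim_infty_ext (fun t => 1 * (- 1 * w t + 1 * winf)
      + 1 * (- (kap + om * kad) * rho t + 1 * (- (kad + om) * dr t + - 1 * ddr t)))).
  - intros t _; unfold g; ring.
  - replace (Finite 0) with (Finite (1 * (- 1 * winf + 1 * winf)
      + 1 * (- (kap + om * kad) * 0 + 1 * (- (kad + om) * 0 + - 1 * 0))))
      by (f_equal; ring).
    apply is_lim_infty_comb.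
    + apply is_lim_infty_comb; [exact Lw | apply is_lim_const].
    + apply is_lim_infty_comb; [exact Lrho|].
      apply is_lim_infty_comb; assumption. }
destruct (lure_converges L2 K lam (damping L2 kad om) (stiffness L1 kap kad om)
         (om * kap) mu m hL2 K1 Hlam K2 K3 K4 Hm Hdis phi Phi p q y
         (fun t => - acceleration kap kad om h w r dr ddr x1 x2 Y t) g rho
         P0 P1 (fun x => proj1 (lure_nonlinearity x))
         (fun x => proj2 (lure_nonlinearity x)) D1 D2 D3 D4 Lg Lrho) as [Lp Lq].
split.
- apply (is_lim_infty_ext (fun t => - 1 * p t + 1 * yss)).
  + intros t _; unfold p; ring.
  + replace (Finite yss) with (Finite (- 1 * 0 + 1 * yss)) by (f_equal; ring).
    apply is_lim_infty_comb; [exact Lp | apply is_lim_const].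
- apply (is_lim_infty_ext (fun t => - 1 * q t + 0 * q t)).
  + intros t _; unfold q; ring.
  + replace (Finite 0) with (Finite (- 1 * 0 + 0 * 0)) by (f_equal; ring).
    apply is_lim_infty_comb; exact Lq.
Qed.

End LureForm.

Lemma sq_le_of_Rabs_le (x b : R) : Rabs x <= b -> x ^ 2 <= b ^ 2.
Proof.
intros H; rewrite <- pow2_abs; apply pow_incr; split; [apply Rabs_pos | exact H].
Qed.

Lemma Rabs_le_1_plus_sq (x S : R) : x ^ 2 <= S -> Rabs x <= 1 + S.
Proof. intros H; rewrite <- pow2_abs in H; nra. Qed.

Lemma loop_initial_error (kap kad om : R) (h : R -> R -> R)
    (w r dr ddr x1 x2 Y : R -> R) :
  integral_loop kap kad om h w r dr ddr x1 x2 Y ->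
  estimation_error kad om h w r dr x1 x2 Y 0 = - (h (r 0) (dr 0) + w 0).
Proof.
intros (_ & _ & _ & E1 & E2 & E3); unfold estimation_error.
rewrite E1, E2, E3; ring.
Qed.

(** The energy bounds the state by a multiple of [1 / sqrt om], down to
    [om = 0]; on a bounded range this is a multiple of [1 / om]. *)
Lemma estimation_error_bounded_bandwidth (L1 L2 L3 kap kad W M E : R) :
  0 < L1 -> 0 < L2 -> 0 < kap -> 0 < kad -> 0 < W ->
  exists eta, 0 < eta /\
  forall (om : R) (h h1 h2 : R -> R -> R) (w r dr ddr x1 x2 Y : R -> R) (winf yss t : R),
    omega_star L1 L2 kap kad < om <= W ->
    has_partials L1 L2 h h1 h2 ->
    (forall s, 0 <= s -> Rabs (w s) <= L3) -> is_lim w p_infty winf ->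
    bounded_reference M yss r dr ddr ->
    Rabs (h (r 0) (dr 0) + w 0) <= E ->
    integral_loop kap kad om h w r dr ddr x1 x2 Y ->
    0 <= t ->
    Rabs (estimation_error kad om h w r dr x1 x2 Y t) <= eta / om.
Proof.
intros hL1 hL2 hkap hkad hW.
destruct (dissipative_below L1 L2 kap kad W hL1 hL2 hkap hkad) as (lam0 & Hlam0 & Hdis).
set (lam := Rmin lam0 1).
assert (Hlam : 0 < lam <= 1) by (split; [apply Rmin_glb_lt; lra | apply Rmin_r]).
set (K := 1 + L1 + L2 + kap + kad + W + W * kad + W * kap).
set (Y0 := E + L1 * M + L2 * M + 2 * L3).
set (G0 := 2 * L3 + 2 * K * M + M).
set (N := 8 * K ^ 3 / coupling K lam * (M ^ 2 + M ^ 2 + Y0 ^ 2)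
          + 256 * K ^ 5 / coupling K lam ^ 3 * (G0 ^ 2 + M ^ 2)).
set (D := 1 + L1 + L2 + 2 * L3 + W * kad * (M + 1) + W * (M + 1)).
set (eta0 := W * (D ^ 2 * (4 * (W + N / kap)))).
exists (1 + Rabs eta0); split; [assert (Hp := Rabs_pos eta0); lra|].
intros om h h1 h2 w r dr ddr x1 x2 Y winf yss t Hom Hh Hw Lw Href HE Hloop Ht.
destruct (Hdis om Hom) as (mu & m & Hm & Hd0).
assert (Hd := dissipative_weaken _ _ _ _ _ _ _ _ (Rmin_l lam0 1) Hd0); fold lam in Hd.
destruct (lure_constants L1 L2 kap kad W om hL1 hL2 hkap hkad Hom)
  as (K1 & K2 & K3 & K4 & K5 & K6).
fold K in K1, K2, K3, K4, K5.
assert (Hwl := limit_bounded w winf L3 Hw Lw).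
set (p := fun t => yss - x1 t); set (q := fun t => - x2 t);
set (y := fun t => Y t + (h yss 0 + winf)).
assert (HM : 0 <= M).
{ destruct (Href 0 (Rle_refl 0)) as [H _]; assert (Hp := Rabs_pos (r 0 - yss)); lra. }
assert (HL3 : 0 <= L3) by (assert (Hp := Rabs_pos (w 0)); specialize (Hw 0 (Rle_refl 0)); lra).
assert (Hstate : om * kap * (p t ^ 2 + q t ^ 2 + y t ^ 2) <= N).
{ assert (HB := loop_state_bounded L1 L2 kap kad W lam om mu m hL1 hL2 hkap hkad Hom
    Hlam Hm Hd h h1 h2 Hh w r dr ddr x1 x2 Y winf yss Hloop (G0 ^ 2 + M ^ 2) t).
  fold K p q y in HB; eapply Rle_trans; [apply HB; [|exact Ht]|].
  - intros s Hs; destruct (Href s Hs) as (R1 & R2 & R3); split.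
    + assert (HG : Rabs (- (w s - winf) - (kap + om * kad) * (r s - yss)
                - (kad + om) * dr s - ddr s) <= G0).
      { specialize (Hwl s Hs).
        assert (0 < om * kad) by nra.
        assert (T1 : Rabs ((kap + om * kad) * (r s - yss)) <= K * M).
        { rewrite Rabs_mult; apply Rmult_le_compat; try apply Rabs_pos; try assumption.
          rewrite Rabs_pos_eq; lra. }
        assert (T2 : Rabs ((kad + om) * dr s) <= K * M).
        { rewrite Rabs_mult; apply Rmult_le_compat; try apply Rabs_pos; try assumption.
          rewrite Rabs_pos_eq by lra.
          unfold K; assert (0 < W * kad) by nra; assert (0 < W * kap) by nra; lra. }
        apply Rabs_le_between in T1; apply Rabs_le_between in T2;
        apply Rabs_le_between in R3; apply Rabs_le_between in Hwl.
        apply Rabs_le_between; unfold G0; lra. }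
      apply sq_le_of_Rabs_le in HG; assert (Hp := pow2_ge_0 M); lra.
    + apply sq_le_of_Rabs_le in R1; assert (Hp := pow2_ge_0 G0); lra.
  - unfold N; apply Rplus_le_compat_r, Rmult_le_compat_l.
    + destruct (coupling_bounds K lam K1 Hlam) as [[He _] _].
      apply Rle_mult_inv_pos; [|exact He].
      assert (HK3 := pow_lt K 3 ltac:(lra)); lra.
    + destruct (Href 0 (Rle_refl 0)) as (R1 & R2 & _).
      destruct Hloop as (_ & _ & _ & E1 & E2 & E3).
      assert (Hp : Rabs (p 0) <= M).
      { unfold p; rewrite E1, Rabs_minus_sym; exact R1. }
      assert (Hq : Rabs (q 0) <= M) by (unfold q; rewrite E2, Rabs_Ropp; exact R2).
      assert (Hy : Rabs (y 0) <= Y0).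
      { assert (Hi := partials_increment L1 L2 h h1 h2 (r 0) yss (dr 0) 0 Hh).
        rewrite (Rabs_minus_sym yss), Rminus_0_l, Rabs_Ropp in Hi.
        specialize (Hwl 0 (Rle_refl 0)).
        unfold y, Y0; rewrite E3.
        assert (L1 * Rabs (r 0 - yss) <= L1 * M) by (apply Rmult_le_compat_l; lra).
        assert (L2 * Rabs (dr 0) <= L2 * M) by (apply Rmult_le_compat_l; lra).
        apply Rabs_le_between in Hwl; apply Rabs_le_between in HE.
        assert (Hi' : Rabs (h yss 0 - h (r 0) (dr 0)) <= L1 * M + L2 * M) by lra.
        apply Rabs_le_between in Hi'.
        apply Rabs_le_between; lra. }
      apply sq_le_of_Rabs_le in Hp; apply sq_le_of_Rabs_le in Hq;
      apply sq_le_of_Rabs_le in Hy; lra. }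
set (S := p t ^ 2 + q t ^ 2 + y t ^ 2) in *.
assert (Hp2 := pow2_ge_0 (p t)); assert (Hq2 := pow2_ge_0 (q t));
assert (Hy2 := pow2_ge_0 (y t)).
assert (Herr : Rabs (estimation_error kad om h w r dr x1 x2 Y t)
        <= D * (1 + Rabs (p t) + Rabs (q t) + Rabs (y t))).
{ assert (Hi := partials_increment L1 L2 h h1 h2 yss (x1 t) 0 (x2 t) Hh).
  rewrite Rminus_0_r, (Rabs_minus_sym (x1 t)) in Hi; fold (p t) in Hi.
  rewrite <- (Rabs_Ropp (x2 t)) in Hi; fold (q t) in Hi.
  destruct (Href t Ht) as (R1 & R2 & _); specialize (Hwl t Ht).
  replace (estimation_error kad om h w r dr x1 x2 Y t)
    with (- y t + - (h (x1 t) (x2 t) - h yss 0) + - (w t - winf)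
          + - (om * kad * ((r t - yss) + p t)) + - (om * (dr t + q t)))
    by (unfold estimation_error, p, q, y; ring).
  assert (A1 := Rabs_pos (p t)); assert (A2 := Rabs_pos (q t)); assert (A3 := Rabs_pos (y t)).
  assert (U1 : Rabs (om * kad * ((r t - yss) + p t)) <= W * kad * (M + Rabs (p t))).
  { rewrite Rabs_mult; apply Rmult_le_compat; try apply Rabs_pos.
    - rewrite Rabs_pos_eq; nra.
    - eapply Rle_trans; [apply Rabs_triang | lra]. }
  assert (U2 : Rabs (om * (dr t + q t)) <= W * (M + Rabs (q t))).
  { rewrite Rabs_mult; apply Rmult_le_compat; try apply Rabs_pos.
    - rewrite Rabs_pos_eq; lra.
    - eapply Rle_trans; [apply Rabs_triang | lra]. }
  assert (Hy := conj (Rle_abs (y t)) (Rle_abs (- y t))); rewrite Rabs_Ropp in Hy.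
  apply Rabs_le_between in Hi; apply Rabs_le_between in Hwl;
  apply Rabs_le_between in U1; apply Rabs_le_between in U2.
  assert (0 <= W * kad) by nra.
  assert (0 <= W * kad * (M + 1)) by nra.
  assert (0 <= W * (M + 1)) by nra.
  assert (V0 : 2 * L3 + W * kad * M + W * M <= D) by (unfold D; lra).
  assert (V1 : (L1 + W * kad) * Rabs (p t) <= D * Rabs (p t))
    by (apply Rmult_le_compat_r; [exact A1 | unfold D; nra]).
  assert (V2 : (L2 + W) * Rabs (q t) <= D * Rabs (q t))
    by (apply Rmult_le_compat_r; [exact A2 | unfold D; nra]).
  assert (V3 : 1 * Rabs (y t) <= D * Rabs (y t))
    by (apply Rmult_le_compat_r; [exact A3 | unfold D; nra]).
  apply Rabs_le_between; lra. }
set (err := estimation_error kad om h w r dr x1 x2 Y t) in *.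
assert (Herr2 : err ^ 2 <= D ^ 2 * (4 * (1 + S))).
{ eapply Rle_trans; [apply sq_le_of_Rabs_le; exact Herr|].
  rewrite Rpow_mult_distr; apply Rmult_le_compat_l; [apply pow2_ge_0|].
  unfold S; rewrite <- (pow2_abs (p t)), <- (pow2_abs (q t)), <- (pow2_abs (y t)).
  assert (J : forall a b c : R, (1 + a + b + c) ^ 2 <= 4 * (1 + (a ^ 2 + b ^ 2 + c ^ 2))).
  { intros a b c; assert (J1 := pow2_ge_0 (1 - a)); assert (J2 := pow2_ge_0 (1 - b));
    assert (J3 := pow2_ge_0 (1 - c)); assert (J4 := pow2_ge_0 (a - b));
    assert (J5 := pow2_ge_0 (a - c)); assert (J6 := pow2_ge_0 (b - c)); nra. }
  apply J. }
assert (HoS : om * S <= N / kap).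
{ apply (Rmult_le_reg_r kap); [exact hkap|].
  replace (N / kap * kap) with N by (field; lra); lra. }
assert (HD2 := pow2_ge_0 D).
assert (HS : 0 <= om * S) by (apply Rmult_le_pos; unfold S; lra).
assert (Hfin : (om * err) ^ 2 <= eta0).
{ replace ((om * err) ^ 2) with (om * (om * err ^ 2)) by ring.
  assert (F : om * err ^ 2 <= D ^ 2 * (4 * (W + N / kap))).
  { apply Rle_trans with (om * (D ^ 2 * (4 * (1 + S)))).
    - apply Rmult_le_compat_l; lra.
    - replace (om * (D ^ 2 * (4 * (1 + S)))) with (D ^ 2 * (4 * (om + om * S))) by ring.
      apply Rmult_le_compat_l; lra. }
  unfold eta0; apply Rmult_le_compat; try lra.
  apply Rmult_le_pos; [lra | apply pow2_ge_0]. }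
apply Rabs_le_1_plus_sq in Hfin.
rewrite Rabs_mult, (Rabs_pos_eq om) in Hfin by lra.
apply (Rmult_le_reg_l om); [exact K6|].
replace (om * ((1 + Rabs eta0) / om)) with (1 + Rabs eta0) by (field; lra).
assert (He := Rle_abs eta0); lra.
Qed.

(** * Large bandwidths *)

(** Derivative of [v ^ 2 / 2 + kap e ^ 2 / 2 + (kad / 2) (e v + kad e ^ 2 / 2)
    + s ^ 2 / 2] along [e' = v], [v' = s - kad v - kap e], [s' = - om s - F]: the
    cascade is stable with a gain that does not depend on [om] once the fast
    variable [s] dominates the coupling [N]. *)
Lemma cascade_decay (kap kad om N F e v s : R) :
  0 < kap -> 0 < kad -> 1 + kad <= N ->
  Rabs F <= N * (1 + Rabs e + Rabs v + Rabs s) ->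
  let c := Rmin kad (kad * kap) / 4 in
  1 + N + 2 * N ^ 2 / c + c <= om ->
  v * (s - kad * v - kap * e) + kap * (e * v)
  + kad / 2 * (v ^ 2 + e * (s - kad * v - kap * e) + kad * (e * v))
  + s * (- F - om * s)
  <= - c * (e ^ 2 + v ^ 2 + s ^ 2) + N ^ 2.
Proof.
intros hkap hkad HN HF c Hom.
assert (Hc : 0 < c) by (unfold c; assert (H := Rmin_glb_lt kad (kad * kap) 0 hkad ltac:(nra)); lra).
assert (Hc1 : 4 * c <= kad) by (unfold c; assert (H := Rmin_l kad (kad * kap)); lra).
assert (Hc2 : 4 * c <= kad * kap) by (unfold c; assert (H := Rmin_r kad (kad * kap)); lra).
assert (He := Rabs_pos e); assert (Hv := Rabs_pos v); assert (Hs := Rabs_pos s).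
assert (HsF : - (s * F) <= Rabs s * (N * (1 + Rabs e + Rabs v + Rabs s))).
{ eapply Rle_trans; [apply Rle_abs|]; rewrite Rabs_Ropp, Rabs_mult.
  apply Rmult_le_compat_l; assumption. }
assert (Hvs : v * s <= Rabs s * Rabs v).
{ eapply Rle_trans; [apply Rle_abs|]; rewrite Rabs_mult; lra. }
assert (Hes : e * s <= Rabs s * Rabs e).
{ eapply Rle_trans; [apply Rle_abs|]; rewrite Rabs_mult; lra. }
replace (v * (s - kad * v - kap * e) + kap * (e * v)
  + kad / 2 * (v ^ 2 + e * (s - kad * v - kap * e) + kad * (e * v))
  + s * (- F - om * s))
  with (- (kad / 2) * v ^ 2 - kad * kap / 2 * e ^ 2 + v * s + kad / 2 * (e * s)
        + - (s * F) - om * s ^ 2) by field.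
rewrite <- (pow2_abs e), <- (pow2_abs v), <- (pow2_abs s).
set (a := Rabs e) in *; set (b := Rabs v) in *; set (d := Rabs s) in *.
assert (Ha2 := pow2_ge_0 a); assert (Hb2 := pow2_ge_0 b); assert (Hd2 := pow2_ge_0 d).
assert (B1 : 4 * c * a ^ 2 <= kad * kap * a ^ 2) by (apply Rmult_le_compat_r; lra).
assert (B2 : 4 * c * b ^ 2 <= kad * b ^ 2) by (apply Rmult_le_compat_r; lra).
assert (B3 : kad / 2 * (e * s) <= N * (d * a)).
{ assert (0 <= d * a) by nra.
  apply Rle_trans with (kad / 2 * (d * a)); [apply Rmult_le_compat_l; lra|].
  apply Rmult_le_compat_r; lra. }
assert (B4 : v * s <= N * (d * b)).
{ assert (0 <= d * b) by nra.
  apply Rle_trans with (1 * (d * b)); [lra | apply Rmult_le_compat_r; lra]. }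
assert (Y1 : 2 * N * d * a <= c * a ^ 2 + N ^ 2 / c * d ^ 2).
{ assert (H := young (2 * c) a (2 * N * d) ltac:(lra)).
  replace (/ (2 * (2 * c)) * (2 * N * d) ^ 2) with (N ^ 2 / c * d ^ 2) in H by (field; lra).
  lra. }
assert (Y2 : 2 * N * d * b <= c * b ^ 2 + N ^ 2 / c * d ^ 2).
{ assert (H := young (2 * c) b (2 * N * d) ltac:(lra)).
  replace (/ (2 * (2 * c)) * (2 * N * d) ^ 2) with (N ^ 2 / c * d ^ 2) in H by (field; lra).
  lra. }
assert (Y3 : N * d <= d ^ 2 + N ^ 2) by (assert (H := pow2_ge_0 (d - N)); nra).
assert (Hod : (1 + N + 2 * N ^ 2 / c + c) * d ^ 2 <= om * d ^ 2)
  by (apply Rmult_le_compat_r; lra).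
unfold Rdiv in *; lra.
Qed.

Lemma estimation_error_large_bandwidth (L1 L2 L3 kap kad M ef0 : R) :
  0 < L1 -> 0 < L2 -> 0 < kap -> 0 < kad ->
  exists W eta, 0 < W /\ 0 < eta /\
  forall (om : R) (h h1 h2 : R -> R -> R) (w dw r dr ddr x1 x2 Y : R -> R) (yss t : R),
    W <= om ->
    has_partials L1 L2 h h1 h2 ->
    (forall u : R * R, continuous (fun v : R * R => h1 (fst v) (snd v)) u) ->
    smooth w dw -> (forall s, 0 <= s -> Rabs (dw s) <= L3) ->
    smooth r dr -> smooth dr ddr ->
    bounded_reference M yss r dr ddr ->
    ef0 = - (h (r 0) (dr 0) + w 0) ->
    integral_loop kap kad om h w r dr ddr x1 x2 Y ->
    0 <= t ->
    Rabs (estimation_error kad om h w r dr x1 x2 Y t)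
      <= Rabs ef0 * exp (- om * t) + eta / om.
Proof.
intros hL1 hL2 hkap hkad.
set (N := 1 + kad + (Rabs L3 + (L1 + L2) * Rabs M) + L1 + L2 * (1 + kad + kap)).
set (c := Rmin kad (kad * kap) / 4).
set (c2 := 1 + kap + kad + kad ^ 2).
set (c3 := Rmin (1 / 8) (kap / 2)).
set (S := (ef0 ^ 2 / 2 + N ^ 2 / (c / c2)) / c3).
set (eta := N * (1 + 3 * (1 + S))).
assert (PM := Rabs_pos M); assert (PL3 := Rabs_pos L3).
assert (HN : 1 + kad <= N) by (unfold N; nra).
assert (Hc : 0 < c) by (unfold c; assert (H := Rmin_glb_lt kad (kad * kap) 0 hkad ltac:(nra)); lra).
assert (Hc2 : 0 < c2) by (unfold c2; nra).
assert (Hc3 : 0 < c3) by (apply Rmin_glb_lt; lra).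
assert (Hrate : 0 < c / c2) by (apply Rdiv_lt_0_compat; assumption).
assert (HN2 := pow2_ge_0 N).
assert (HS : 0 <= S).
{ apply Rle_mult_inv_pos; [|exact Hc3].
  assert (0 <= N ^ 2 / (c / c2)) by (apply Rle_mult_inv_pos; assumption).
  assert (He := pow2_ge_0 ef0); lra. }
assert (Heta : 0 < eta) by (unfold eta; nra).
exists (1 + N + 2 * N ^ 2 / c + c), eta.
split; [|split; [exact Heta|]].
{ assert (0 <= 2 * N ^ 2 / c) by (apply Rle_mult_inv_pos; lra); lra. }
intros om h h1 h2 w dw r dr ddr x1 x2 Y yss t Hom Hh Hh1 Sw Hdw Sr Sdr Href Hef0 Hloop Ht.
assert (Hom0 : 0 < om).
{ assert (0 <= 2 * N ^ 2 / c) by (apply Rle_mult_inv_pos; lra); lra. }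
assert (Hinit := loop_initial_error _ _ _ _ _ _ _ _ _ _ _ Hloop); rewrite <- Hef0 in Hinit.
destruct Hloop as (S1 & S2 & S3 & I1 & I2 & I3).
set (e := fun u => r u - x1 u); set (v := fun u => dr u - x2 u).
set (s := estimation_error kad om h w r dr x1 x2 Y) in *.
set (acc := acceleration kap kad om h w r dr ddr x1 x2 Y) in *.
assert (Hacc : forall u, acc u = ddr u - s u + kad * v u + kap * e u).
{ intros u; assert (H := error_equation kap kad om h w r dr ddr x1 x2 Y u).
  fold acc s in H; unfold v, e; lra. }
set (F := fun u => h1 (x1 u) (x2 u) * x2 u + h2 (x1 u) (x2 u) * acc u + dw u).
assert (Se : smooth e v).
{ intros u Hu; assert (H1 := Sr u Hu); assert (H2 := S1 u Hu).
  unfold e, v; derive_by_hyps; ring. }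
assert (Sv : smooth v (fun u => s u - kad * v u - kap * e u)).
{ intros u Hu; assert (H1 := Sdr u Hu); assert (H2 := S2 u Hu); fold acc in H2.
  unfold v at 1; derive_by_hyps; rewrite Hacc; ring. }
assert (Ss : smooth s (fun u => - om * s u + - F u)).
{ intros u Hu; assert (H1 := Se u Hu); assert (H2 := Sv u Hu); assert (H3 := S3 u Hu);
  assert (H4 := Sw u Hu).
  set (hx := fun z => h (x1 z) (x2 z)).
  assert (H5 : is_derive hx u (h1 (x1 u) (x2 u) * x2 u + h2 (x1 u) (x2 u) * acc u)).
  { apply (partials_chain_rule L1 L2 h h1 h2); try assumption;
      [apply S1 | apply S2]; exact Hu. }
  simpl in H2, H3.
  change (is_derive (fun z => - (hx z + w z) - om * (kad * e z + v z) - Y z) u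
            (- om * s u + - F u)).
  derive_by_hyps; unfold F, e; ring. }
assert (HF : forall u, 0 <= u -> Rabs (F u) <= N * (1 + Rabs (e u) + Rabs (v u) + Rabs (s u))).
{ intros u Hu; destruct (Href u Hu) as (_ & R2 & R3); specialize (Hdw u Hu).
  destruct (Hh (x1 u) (x2 u)) as (_ & _ & B1 & B2).
  assert (RM := Rle_abs M); assert (RL3 := Rle_abs L3).
  assert (Ae := Rabs_pos (e u)); assert (Av := Rabs_pos (v u)); assert (As := Rabs_pos (s u)).
  assert (U1 : Rabs (x2 u) <= Rabs M + Rabs (v u)).
  { replace (x2 u) with (dr u + - v u) by (unfold v; ring).
    eapply Rle_trans; [apply Rabs_triang|]; rewrite Rabs_Ropp; lra. }
  assert (U2 : Rabs (acc u) <= Rabs M + Rabs (s u) + kad * Rabs (v u) + kap * Rabs (e u)).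
  { rewrite Hacc.
    eapply Rle_trans; [apply Rabs_triang|]; rewrite (Rabs_mult kap), (Rabs_pos_eq kap) by lra.
    apply Rplus_le_compat_r.
    eapply Rle_trans; [apply Rabs_triang|]; rewrite (Rabs_mult kad), (Rabs_pos_eq kad) by lra.
    apply Rplus_le_compat_r.
    eapply Rle_trans; [apply Rabs_triang|]; rewrite Rabs_Ropp; lra. }
  assert (T1 : Rabs (h1 (x1 u) (x2 u) * x2 u) <= L1 * (Rabs M + Rabs (v u))).
  { rewrite Rabs_mult; apply Rmult_le_compat; try apply Rabs_pos; assumption. }
  assert (T2 : Rabs (h2 (x1 u) (x2 u) * acc u)
               <= L2 * (Rabs M + Rabs (s u) + kad * Rabs (v u) + kap * Rabs (e u))).
  { rewrite Rabs_mult; apply Rmult_le_compat; try apply Rabs_pos; assumption. }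
  assert (T : Rabs (F u) <= L1 * (Rabs M + Rabs (v u))
     + L2 * (Rabs M + Rabs (s u) + kad * Rabs (v u) + kap * Rabs (e u)) + Rabs L3).
  { unfold F; eapply Rle_trans; [apply Rabs_triang|].
    apply Rplus_le_compat; [|lra].
    eapply Rle_trans; [apply Rabs_triang|].
    apply Rplus_le_compat; assumption. }
  assert (Hk1 : 0 <= (L1 + L2) * Rabs M) by nra.
  assert (Hk2 : 0 <= L2 * kad) by nra.
  assert (Hk3 : 0 <= L2 * kap) by nra.
  assert (V1 : L2 * kap * Rabs (e u) <= N * Rabs (e u))
    by (apply Rmult_le_compat_r; [exact Ae | unfold N; lra]).
  assert (V2 : (L1 + L2 * kad) * Rabs (v u) <= N * Rabs (v u))
    by (apply Rmult_le_compat_r; [exact Av | unfold N; lra]).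
  assert (V3 : L2 * Rabs (s u) <= N * Rabs (s u))
    by (apply Rmult_le_compat_r; [exact As | unfold N; lra]).
  assert (V0 : (L1 + L2) * Rabs M + Rabs L3 <= N) by (unfold N; lra).
  lra. }
set (V := fun u => v u ^ 2 / 2 + kap * e u ^ 2 / 2
           + kad / 2 * (e u * v u + kad * e u ^ 2 / 2) + s u ^ 2 / 2).
set (dV := fun u => v u * (s u - kad * v u - kap * e u) + kap * (e u * v u)
  + kad / 2 * (v u ^ 2 + e u * (s u - kad * v u - kap * e u) + kad * (e u * v u))
  + s u * (- F u - om * s u)).
assert (SV : smooth V dV).
{ intros u Hu; assert (H1 := Se u Hu); assert (H2 := Sv u Hu); assert (H3 := Ss u Hu).
  simpl in H2, H3.
  unfold V, dV; derive_by_hyps; field. }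
assert (Vup : forall u, V u <= c2 * (e u ^ 2 + v u ^ 2 + s u ^ 2)).
{ intros u; unfold V, c2.
  assert (H1 := pow2_ge_0 (e u)); assert (H2 := pow2_ge_0 (v u)); assert (H3 := pow2_ge_0 (s u)).
  assert (H4 : e u * v u <= e u ^ 2 + v u ^ 2) by (assert (H := pow2_ge_0 (e u - v u)); nra).
  assert (H5 : kad * (e u * v u) <= kad * (e u ^ 2 + v u ^ 2)) by (apply Rmult_le_compat_l; lra).
  assert (H6 : 0 < kad ^ 2) by nra.
  nra. }
assert (Vlow : forall u, c3 * (e u ^ 2 + v u ^ 2 + s u ^ 2) <= V u).
{ intros u; assert (Q1 := Rmin_l (1 / 8) (kap / 2)); assert (Q2 := Rmin_r (1 / 8) (kap / 2)).
  fold c3 in Q1, Q2.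
  assert (H1 := pow2_ge_0 (e u)); assert (H2 := pow2_ge_0 (v u)); assert (H3 := pow2_ge_0 (s u)).
  assert (c3 * e u ^ 2 <= kap / 2 * e u ^ 2) by (apply Rmult_le_compat_r; assumption).
  assert (c3 * v u ^ 2 <= 1 / 8 * v u ^ 2) by (apply Rmult_le_compat_r; assumption).
  assert (c3 * s u ^ 2 <= 1 / 8 * s u ^ 2) by (apply Rmult_le_compat_r; assumption).
  assert (Q3 := pow2_ge_0 (kad * e u)).
  assert (Q4 := pow2_ge_0 (v u + 2 * (kad * e u) / 3)).
  unfold V; nra. }
assert (HV0 : V 0 = ef0 ^ 2 / 2).
{ unfold V, e, v; rewrite Hinit, I1, I2; field. }
assert (HSt : forall u, 0 <= u -> e u ^ 2 + v u ^ 2 + s u ^ 2 <= S).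
{ intros u Hu.
  assert (HVu : V u <= V 0 + N ^ 2 / (c / c2)).
  { apply (comparison_bound V dV); try assumption.
    - rewrite HV0; assert (H := pow2_ge_0 ef0); lra.
    - intros z Hz.
      assert (H := cascade_decay kap kad om N (F z) (e z) (v z) (s z) hkap hkad HN
                     (HF z Hz) Hom); fold c in H.
      eapply Rle_trans; [exact H|]; apply Rplus_le_compat_r.
      assert (c / c2 * V z <= c / c2 * (c2 * (e z ^ 2 + v z ^ 2 + s z ^ 2)))
        by (apply Rmult_le_compat_l; [lra | apply Vup]).
      replace (c / c2 * (c2 * (e z ^ 2 + v z ^ 2 + s z ^ 2)))
        with (c * (e z ^ 2 + v z ^ 2 + s z ^ 2)) in * by (field; lra).
      lra. }
  apply (Rmult_le_reg_l c3); [exact Hc3|].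
  replace (c3 * S) with (ef0 ^ 2 / 2 + N ^ 2 / (c / c2)) by (unfold S; field; lra).
  specialize (Vlow u); lra. }
rewrite <- Hinit.
apply (forced_decay_bound s (fun u => - F u) om eta t Hom0 Ht Ss).
intros u Hu; rewrite Rabs_Ropp; eapply Rle_trans; [exact (HF u Hu)|].
specialize (HSt u Hu).
assert (H1 := pow2_ge_0 (e u)); assert (H2 := pow2_ge_0 (v u)); assert (H3 := pow2_ge_0 (s u)).
assert (J1 := Rabs_le_1_plus_sq (e u) S ltac:(lra));
assert (J2 := Rabs_le_1_plus_sq (v u) S ltac:(lra));
assert (J3 := Rabs_le_1_plus_sq (s u) S ltac:(lra)).
apply Rmult_le_compat_l; lra.
Qed.

(** * All bandwidths above the threshold *)

Lemma loop_error_bound (L1 L2 L3 kap kad M ef0 : R) :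
  0 < L1 -> 0 < L2 -> 0 < kap -> 0 < kad ->
  exists eta1 eta2, 0 < eta1 /\ 0 < eta2 /\
  forall (om : R) (h h1 h2 : R -> R -> R) (w dw r dr ddr x1 x2 Y : R -> R) (winf yss : R),
    omega_star L1 L2 kap kad < om ->
    has_partials L1 L2 h h1 h2 ->
    (forall u : R * R, continuous (fun v : R * R => h1 (fst v) (snd v)) u) ->
    smooth w dw -> (forall s, 0 <= s -> Rabs (w s) <= L3 /\ Rabs (dw s) <= L3) ->
    is_lim w p_infty winf ->
    smooth r dr -> smooth dr ddr -> bounded_reference M yss r dr ddr ->
    ef0 = - (h (r 0) (dr 0) + w 0) ->
    integral_loop kap kad om h w r dr ddr x1 x2 Y ->
    forall t, 0 <= t ->
    Rabs (estimation_error kad om h w r dr x1 x2 Y t)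
      <= eta1 * exp (- om * t) + eta2 / om.
Proof.
intros hL1 hL2 hkap hkad.
destruct (estimation_error_large_bandwidth L1 L2 L3 kap kad M ef0 hL1 hL2 hkap hkad)
  as (W & eta & HW & Heta & Hlarge).
destruct (estimation_error_bounded_bandwidth L1 L2 L3 kap kad W M (Rabs ef0)
            hL1 hL2 hkap hkad HW) as (eta' & Heta' & Hsmall).
exists (Rabs ef0 + 1), (eta + eta').
assert (Ha := Rabs_pos ef0).
split; [lra | split; [lra|]].
intros om h h1 h2 w dw r dr ddr x1 x2 Y winf yss Hom Hh Hh1 Sw Hw Lw Sr Sdr Href Hef0 Hloop t Ht.
destruct (omega_star_lower_bounds L1 L2 kap kad hkad) as [H0 _].
assert (Hom0 : 0 < om) by lra.
assert (He := exp_pos (- om * t)).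
assert (Hi := Rinv_0_lt_compat om Hom0).
assert (0 <= Rabs ef0 * exp (- om * t)) by (apply Rmult_le_pos; lra).
assert (0 < eta * / om) by (apply Rmult_lt_0_compat; assumption).
assert (0 < eta' * / om) by (apply Rmult_lt_0_compat; assumption).
destruct (Rle_or_lt W om) as [Hcase|Hcase].
- assert (Hl := Hlarge om h h1 h2 w dw r dr ddr x1 x2 Y yss t Hcase Hh Hh1 Sw
    (fun s Hs => proj2 (Hw s Hs)) Sr Sdr Href Hef0 Hloop Ht).
  unfold Rdiv in *; lra.
- assert (Hs := Hsmall om h h1 h2 w r dr ddr x1 x2 Y winf yss t
    (conj Hom (Rlt_le _ _ Hcase)) Hh (fun s Hs => proj1 (Hw s Hs)) Lw Href).
  rewrite Hef0, Rabs_Ropp in Hs at 1; specialize (Hs (Rle_refl _) Hloop Ht).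
  unfold Rdiv in *; lra.
Qed.

Lemma loop_converges (L1 L2 L3 kap kad om : R) (h h1 h2 : R -> R -> R)
    (w r dr ddr x1 x2 Y : R -> R) (winf yss : R) :
  0 < L1 -> 0 < L2 -> 0 < kap -> 0 < kad ->
  omega_star L1 L2 kap kad < om ->
  has_partials L1 L2 h h1 h2 -> is_lim w p_infty winf ->
  is_lim r p_infty yss -> is_lim dr p_infty 0 -> is_lim ddr p_infty 0 ->
  integral_loop kap kad om h w r dr ddr x1 x2 Y ->
  is_lim x1 p_infty yss /\ is_lim x2 p_infty 0.
Proof.
intros hL1 hL2 hkap hkad Hom Hh Lw Lr Ldr Lddr Hloop.
destruct (dissipative_below L1 L2 kap kad om hL1 hL2 hkap hkad) as (lam0 & Hlam0 & Hdis).
destruct (Hdis om (conj Hom (Rle_refl om))) as (mu & m & Hm & Hd).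
apply (loop_state_converges L1 L2 kap kad om (Rmin lam0 1) om mu m)
  with (h := h) (h1 := h1) (h2 := h2) (w := w) (r := r) (dr := dr) (ddr := ddr) (Y := Y)
       (winf := winf); try assumption.
- split; [exact Hom | apply Rle_refl].
- split; [apply Rmin_glb_lt; lra | apply Rmin_r].
- apply (dissipative_weaken _ _ _ _ _ _ lam0); [apply Rmin_l | exact Hd].
Qed.

(** * From the two controllers to the loop *)

Lemma smooth_eq (g dg dg' : R -> R) :
  (forall t, 0 <= t -> dg t = dg' t) -> smooth g dg -> smooth g dg'.
Proof. intros E H t Ht; rewrite <- E by exact Ht; exact (H t Ht). Qed.

(** Continuity of [∂h/∂x1], which the chain rule needs, is inherited from that of
    [∂f/∂x1] at time [0]. *)
Lemma class_F_decomposition (L1 L2 L3 : R) (f : R -> R -> R -> R) :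
  class_F L1 L2 L3 f ->
  exists (h h1 h2 : R -> R -> R) (w dw : R -> R) (winf : R),
    (forall x1 x2 t, 0 <= t -> f x1 x2 t = h x1 x2 + w t) /\
    has_partials L1 L2 h h1 h2 /\
    (forall u : R * R, continuous (fun v : R * R => h1 (fst v) (snd v)) u) /\
    smooth w dw /\
    (forall s, 0 <= s -> Rabs (w s) <= L3 /\ Rabs (dw s) <= L3) /\
    is_lim w p_infty winf.
Proof.
intros [[_ (f1 & f2 & Hf & Hf1 & _)]
        (h & h1 & h2 & w0 & dw & Efh & Hh & Sw0 & Hw0 & [winf Lw0])].
destruct (smooth_extension _ _ Sw0) as (w & Ew & Sw).
assert (Eh1 : forall x1 x2, h1 x1 x2 = f1 x1 x2 0).
{ intros x1 x2.
  assert (H1 := is_derive_unique _ _ _ (proj1 (Hf x1 x2 0 (Rle_refl 0)))).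
  rewrite <- H1; symmetry; apply is_derive_unique.
  apply (is_derive_ext (fun x => h x x2 + w0 0)).
  - intros x; symmetry; apply Efh; apply Rle_refl.
  - set (hx := fun x => h x x2).
    assert (H2 : is_derive hx x1 (h1 x1 x2)) by apply Hh.
    clear H1.
    change (is_derive (fun x => hx x + w0 0) x1 (h1 x1 x2)).
    derive_by_hyps; ring. }
exists h, h1, h2, w, dw, winf.
split; [|split; [exact Hh|split; [|split; [exact Sw|split]]]].
- intros x1 x2 t Ht; rewrite Ew by exact Ht; exact (Efh x1 x2 t Ht).
- intros u.
  apply (continuous_ext (fun v : R * R => f1 (fst v) (snd v) 0)).
  + intros v; symmetry; apply Eh1.
  + assert (Hc := Hf1 (u, 0) (Rle_refl 0)).
    refine (filterlim_comp _ _ _ (fun v : R * R => (v, 0)) _ _ _ _ _ Hc).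
    intros P [d Hd]; exists d; intros v Hv.
    apply (Hd (v, 0)); [|apply Rle_refl].
    split; [exact Hv | apply ball_center].
- intros s Hs; rewrite Ew by exact Hs; exact (Hw0 s Hs).
- apply (is_lim_infty_ext w0); [|exact Lw0].
  intros t Ht; symmetry; exact (Ew t Ht).
Qed.

Lemma smooth_clamp_continuous (g dg : R -> R) :
  smooth g dg -> forall s, continuous (fun s => g (Rmax 0 s)) s.
Proof.
intros Hg s.
assert (E : forall z : R, / 2 * (z + Rabs z) = Rmax 0 z).
{ intros z; unfold Rmax; destruct (Rle_dec 0 z).
  - rewrite Rabs_pos_eq by assumption; field.
  - rewrite Rabs_left by lra; field. }
apply (continuous_comp (fun s => Rmax 0 s) g).
- apply (continuous_ext (fun s => / 2 * (s + Rabs s))); [exact E|].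
  apply (continuous_mult (fun _ => / 2) (fun s => s + Rabs s));
    [apply continuous_const|].
  apply (continuous_plus (fun s => s) Rabs);
    [apply continuous_id | apply continuous_Rabs].
- apply (ex_derive_continuous (K := R_AbsRing) (V := R_NormedModule)).
  eexists; apply Hg, Rmax_l.
Qed.

(** Clamping the integrand at its value at [0] makes it continuous on both sides
    of [0], where the integral must be differentiable. *)
Lemma smooth_integral (g dg : R -> R) :
  smooth g dg -> exists G, G 0 = 0 /\ smooth G g /\
    forall t, 0 <= t -> G t = RInt g 0 t.
Proof.
intros Hg; assert (Hc := smooth_clamp_continuous g dg Hg).
exists (fun t => RInt (fun s => g (Rmax 0 s)) 0 t); split; [|split].
- rewrite RInt_point; reflexivity.
- intros t Ht.
  apply (is_derive_value _ _ (g (Rmax 0 t))); [|rewrite Rmax_right by exact Ht; reflexivity].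
  apply (is_derive_RInt (fun s => g (Rmax 0 s)) _ 0); [|apply Hc].
  apply filter_forall; intros b.
  apply (RInt_correct (V := R_CompleteNormedModule)).
  apply (ex_RInt_continuous (V := R_CompleteNormedModule)).
  intros z _; apply Hc.
- intros t Ht; apply RInt_ext; intros s Hs.
  rewrite Rmin_left in Hs by exact Ht; rewrite Rmax_right by lra; reflexivity.
Qed.

Section Controllers.

Variables kap kad om x10 x20 : R.
Variables (f : R -> R -> R -> R) (h : R -> R -> R) (w : R -> R).
Hypothesis Hf : forall x1 x2 t, 0 <= t -> f x1 x2 t = h x1 x2 + w t.
Variables r r' dr dr' ddr : R -> R.
Hypothesis Er : forall t, 0 <= t -> r' t = r t.
Hypothesis Edr : forall t, 0 <= t -> dr' t = dr t.
Hypothesis Sr : smooth r' dr'.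
Hypothesis Sdr : smooth dr' ddr.
Hypothesis Hr0 : r 0 = x10.
Hypothesis Hdr0 : dr 0 = x20.

Lemma PID_integral_loop (x1 x2 u : R -> R) :
  PID_closed_loop f (kap + om * kad) (kad + om) (om * kap) x10 x20 r dr ddr x1 x2 u ->
  exists x1' x2' Y,
    integral_loop kap kad om h w r' dr' ddr x1' x2' Y /\
    forall t, 0 <= t -> x1' t = x1 t /\ x2' t = x2 t /\
      ddr t - (f (x1 t) (x2 t) t + u t) + kad * (dr t - x2 t) + kap * (r t - x1 t)
      = estimation_error kad om h w r' dr' x1' x2' Y t.
Proof.
intros [(D1 & D2 & I1 & I2) Hu].
destruct (smooth_extension _ _ D1) as (x1' & E1 & S1).
destruct (smooth_extension _ _ D2) as (x2' & E2 & S2).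
destruct (smooth_integral (fun t => x1' t - r' t) (fun t => x2 t - dr' t))
  as (G & G0 & SG & EG).
{ intros t Ht; assert (H1 := S1 t Ht); assert (H2 := Sr t Ht); derive_by_hyps; ring. }
assert (EI : forall t, 0 <= t -> RInt (fun s => x1 s - r s) 0 t = G t).
{ intros t Ht; rewrite (EG t Ht); apply RInt_ext; intros s Hs.
  rewrite Rmin_left in Hs by exact Ht; rewrite E1, Er by lra; reflexivity. }
assert (Eu : forall t, 0 <= t -> f (x1 t) (x2 t) t + u t
  = acceleration kap kad om h w r' dr' ddr x1' x2' (fun t => - (om * kap) * G t) t).
{ intros t Ht; rewrite Hf, Hu, EI by exact Ht; unfold acceleration.
  rewrite E1, E2, Er, Edr by exact Ht; ring. }
exists x1', x2', (fun t => - (om * kap) * G t); split.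
- split; [|split; [|split; [|split; [|split]]]].
  + apply (smooth_eq _ x2); [|exact S1]; intros t Ht; symmetry; exact (E2 t Ht).
  + apply (smooth_eq _ (fun t => f (x1 t) (x2 t) t + u t)); assumption.
  + intros t Ht; assert (H := SG t Ht); simpl in H; derive_by_hyps; ring.
  + rewrite E1, Er by apply Rle_refl; congruence.
  + rewrite E2, Edr by apply Rle_refl; congruence.
  + rewrite G0; ring.
- intros t Ht; split; [exact (E1 t Ht) | split; [exact (E2 t Ht)|]].
  rewrite Eu, <- (error_equation kap kad om h w r' dr' ddr) by exact Ht.
  rewrite E1, E2, Er, Edr by exact Ht; reflexivity.
Qed.

Lemma ADRC_integral_loop (x1 x2 xi fhat u : R -> R) :
  ADRC_closed_loop f kap kad om x10 x20 r dr ddr x1 x2 xi fhat u ->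
  exists x1' x2' Y,
    integral_loop kap kad om h w r' dr' ddr x1' x2' Y /\
    forall t, 0 <= t ->
      fhat t - f (x1 t) (x2 t) t = estimation_error kad om h w r' dr' x1' x2' Y t.
Proof.
intros ((D1 & D2 & I1 & I2) & D3 & I3 & Hfh & Hu).
destruct (smooth_extension _ _ D1) as (x1' & E1 & S1).
destruct (smooth_extension _ _ D2) as (x2' & E2 & S2).
destruct (smooth_extension _ _ D3) as (xi' & E3 & S3).
set (Y := fun t => - (xi' t + om * x2' t)
                   - om * (kad * (r' t - x1' t) + (dr' t - x2' t))).
assert (Eu : forall t, 0 <= t -> f (x1 t) (x2 t) t + u t
  = acceleration kap kad om h w r' dr' ddr x1' x2' Y t).
{ intros t Ht; rewrite Hf, Hu, Hfh by exact Ht; unfold acceleration, Y.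
  rewrite E1, E2, E3, Er, Edr by exact Ht; ring. }
exists x1', x2', Y; split.
- split; [|split; [|split; [|split; [|split]]]].
  + apply (smooth_eq _ x2); [|exact S1]; intros t Ht; symmetry; exact (E2 t Ht).
  + apply (smooth_eq _ (fun t => f (x1 t) (x2 t) t + u t)); assumption.
  + intros t Ht; assert (H1 := S1 t Ht); assert (H2 := S2 t Ht); assert (H3 := S3 t Ht);
    assert (H4 := Sr t Ht); assert (H5 := Sdr t Ht); simpl in H2, H3.
    unfold Y; derive_by_hyps.
    rewrite Hu, Hfh by exact Ht; rewrite E1, Er, Edr by exact Ht; ring.
  + rewrite E1, Er by apply Rle_refl; congruence.
  + rewrite E2, Edr by apply Rle_refl; congruence.
  + unfold Y; rewrite E1, E2, E3, Er, Edr by apply Rle_refl.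
    rewrite I3, I1, I2, Hr0, Hdr0; ring.
- intros t Ht; rewrite Hf, Hfh by exact Ht; unfold estimation_error, Y.
  rewrite E1, E2, E3 by exact Ht; ring.
Qed.

End Controllers.

Theorem corollary1 (L1 L2 L3 kap kad : R)
    (hL1 : 0 < L1) (hL2 : 0 < L2) (hL3 : 0 < L3)
    (hkap : 0 < kap) (hkad : 0 < kad)
    (ef0 : R) (dr ddr : R -> R) :
  exists eta1 eta2 : R, 0 < eta1 /\ 0 < eta2 /\
  forall (f : R -> R -> R -> R) (x10 x20 : R)
         (ystar : R -> R) (yss cr : R) (r : R -> R),
    class_F L1 L2 L3 f ->
    reference_signal ystar yss ->
    0 < cr ->
    transient_process cr ystar x10 x20 r dr ddr ->
    ef0 = - f x10 x20 0 ->
  forall omega_o : R, omega_star L1 L2 kap kad < omega_o ->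
    (forall x1 x2 xi fhat u : R -> R,
       ADRC_closed_loop f kap kad omega_o x10 x20 r dr ddr x1 x2 xi fhat u ->
       let e := fun t => r t - x1 t in
       let ef := fun t => fhat t - f (x1 t) (x2 t) t in
       exists de dde : R -> R,
         deriv_nonneg e de /\ deriv_nonneg de dde /\
         forall t, 0 <= t ->
           Rabs (dde t + kad * de t + kap * e t) = Rabs (ef t) /\
           Rabs (ef t) <= eta1 * exp (- omega_o * t) + eta2 / omega_o)
    /\
    (forall x1 x2 u : R -> R,
       PID_closed_loop f (kap + omega_o * kad) (kad + omega_o) (omega_o * kap)
         x10 x20 r dr ddr x1 x2 u ->
       let e := fun t => r t - x1 t in
       (is_lim x1 p_infty yss /\ is_lim x2 p_infty 0) /\
       exists de dde : R -> R,
         deriv_nonneg e de /\ deriv_nonneg de dde /\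
         forall t, 0 <= t ->
           Rabs (dde t + kad * de t + kap * e t)
             <= eta1 * exp (- omega_o * t) + eta2 / omega_o).
Proof.
(* If no reference produces the given [dr] and [ddr], the claim is vacuous. *)
assert (HM : exists M, forall cr ystar yss x10 x20 r,
  reference_signal ystar yss -> 0 < cr ->
  transient_process cr ystar x10 x20 r dr ddr -> bounded_reference M yss r dr ddr).
{ destruct (classic (exists cr ystar yss x10 x20 r, reference_signal ystar yss /\
    0 < cr /\ transient_process cr ystar x10 x20 r dr ddr))
    as [(cr & ystar & yss & x10 & x20 & r & Href & Hcr & Htr)|Hnone].
  - destruct (transient_tracks ystar yss cr x10 x20 r dr ddr Href Hcr Htr)
      as [[M HM] [Lr _]].
    exists M; intros cr' ystar' yss' x10' x20' r' Href' Hcr' Htr' t Ht.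
    destruct (transient_tracks ystar' yss' cr' x10' x20' r' dr ddr Href' Hcr' Htr')
      as [_ [Lr' _]].
    rewrite (deviation_determined_by_velocity r' r dr yss' yss (proj1 Htr') (proj1 Htr)
               Lr' Lr t Ht).
    exact (HM t Ht).
  - exists 0; intros cr ystar yss x10 x20 r Href Hcr Htr; exfalso; apply Hnone.
    exists cr, ystar, yss, x10, x20, r; repeat split; assumption || apply Htr. }
destruct HM as [M HM].
destruct (loop_error_bound L1 L2 L3 kap kad M ef0 hL1 hL2 hkap hkad)
  as (eta1 & eta2 & He1 & He2 & Hbound).
exists eta1, eta2; split; [exact He1 | split; [exact He2|]].
intros f x10 x20 ystar yss cr r Hclass Href Hcr Htr Hef0 om Hom.
specialize (HM cr ystar yss x10 x20 r Href Hcr Htr).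
destruct (transient_tracks ystar yss cr x10 x20 r dr ddr Href Hcr Htr)
  as (_ & Lr & Ldr & Lddr).
destruct (class_F_decomposition L1 L2 L3 f Hclass)
  as (h & h1 & h2 & w & dw & winf & Hf & Hh & Hh1 & Sw & Hw & Lw).
destruct Htr as (Dr & Ddr & _ & Hr0 & Hdr0).
destruct (smooth_extension _ _ Dr) as (r' & Er & Sr).
destruct (smooth_extension _ _ Ddr) as (dr' & Edr & Sdr).
assert (Sr' : smooth r' dr').
{ apply (smooth_eq _ dr); [|exact Sr]; intros t Ht; symmetry; exact (Edr t Ht). }
assert (Href' : bounded_reference M yss r' dr' ddr).
{ intros t Ht; rewrite Er, Edr by exact Ht; exact (HM t Ht). }
assert (Hinit : ef0 = - (h (r' 0) (dr' 0) + w 0)).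
{ rewrite Er, Edr, Hr0, Hdr0, <- Hf by apply Rle_refl; exact Hef0. }
assert (Hlb : forall x1 x2 Y, integral_loop kap kad om h w r' dr' ddr x1 x2 Y ->
  forall t, 0 <= t -> Rabs (estimation_error kad om h w r' dr' x1 x2 Y t)
      <= eta1 * exp (- om * t) + eta2 / om).
{ intros x1 x2 Y Hloop.
  apply (Hbound om h h1 h2 w dw r' dr' ddr x1 x2 Y winf yss); assumption. }
split.
- intros x1 x2 xi fhat u Hadrc e ef.
  exists (fun t => dr t - x2 t), (fun t => ddr t - (f (x1 t) (x2 t) t + u t)).
  destruct (ADRC_integral_loop kap kad om x10 x20 f h w Hf r r' dr dr' ddr Er Edr Sr' Sdr
              Hr0 Hdr0 x1 x2 xi fhat u Hadrc) as (x1' & x2' & Y & Hloop & Herr).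
  destruct Hadrc as ((D1 & D2 & _) & _ & _ & _ & Hu).
  split; [|split].
  + intros t Ht; apply Dminus; [apply Dr | apply D1]; exact Ht.
  + intros t Ht; apply Dminus; [apply Ddr | apply D2]; exact Ht.
  + intros t Ht; split.
    * f_equal; unfold e, ef; rewrite Hu by exact Ht; ring.
    * unfold ef; rewrite Herr by exact Ht; exact (Hlb _ _ _ Hloop t Ht).
- intros x1 x2 u Hpid e.
  destruct (PID_integral_loop kap kad om x10 x20 f h w Hf r r' dr dr' ddr Er Edr Sr'
              Hr0 Hdr0 x1 x2 u Hpid) as (x1' & x2' & Y & Hloop & Herr).
  destruct Hpid as ((D1 & D2 & _) & _).
  split.
  + destruct (loop_converges L1 L2 L3 kap kad om h h1 h2 w r' dr' ddr x1' x2' Y winf yss)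
      as [C1 C2]; try assumption.
    * apply (is_lim_infty_ext r); [|exact Lr]; intros t Ht; symmetry; exact (Er t Ht).
    * apply (is_lim_infty_ext dr); [|exact Ldr]; intros t Ht; symmetry; exact (Edr t Ht).
    * split.
      -- apply (is_lim_infty_ext x1'); [|exact C1]; intros t Ht; apply (Herr t Ht).
      -- apply (is_lim_infty_ext x2'); [|exact C2]; intros t Ht; apply (Herr t Ht).
  + exists (fun t => dr t - x2 t), (fun t => ddr t - (f (x1 t) (x2 t) t + u t)).
    split; [|split].
    * intros t Ht; apply Dminus; [apply Dr | apply D1]; exact Ht.
    * intros t Ht; apply Dminus; [apply Ddr | apply D2]; exact Ht.
    * intros t Ht; destruct (Herr t Ht) as (_ & _ & E); unfold e; rewrite E.
      exact (Hlb _ _ _ Hloop t Ht).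
Qed.
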